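(* Let $f\in L^1[0,1]$ and $\gamma>0$. Let $P_\gamma$ be the continuous $L^1$-Potts functional of $f$, and let $(P^k_\gamma)_{k\in\mathbb N}$ be the discrete $L^1$-Potts functionals associated with $f$, the discretization sets $(X^k)$ and the sampling operators $(S_k)$, where the $S_k$ are given by integral sampling or, in case $f$ is continuous on $[0,1]$, alternatively by point sampling. Then the functionals $P^k_\gamma$ $\Gamma$-converge to $P_\gamma$ (with respect to the $L^1[0,1]$-norm) as $k\to\infty$. Each sequence $(u^k)$, where $u^k$ is a minimizer of $P^k_\gamma$, has at least one accumulation point in $L^1[0,1]$. Each such accumulation point $u^\ast$ is a minimizer of $P_\gamma$, i.e., $P_\gamma(u^\ast)=\inf_{v\in L^1[0,1]}P_\gamma(v)$.
   Context: $\mathrm{PC}[0,1]\subset L^1[0,1]$ is the set of (equivalence classes of) piecewise constant functions on $[0,1]$ with finitely many jumps; for $u\in \mathrm{PC}[0,1]$, $J(u)$ is the number of jumps of $u$ in $(0,1)$, i.e. the number of points in the support of its distributional derivative. The continuous $L^1$-Potts functional is $P_\gamma:L^1[0,1]\to[0,\infty]$, $P_\gamma(u)=\gamma J(u)+\|u-f\|_1$ if $u\in\mathrm{PC}[0,1]$ and $P_\gamma(u)=\infty$ otherwise. Discretization sets: $X^1\subset X^2\subset\cdots$ is a nested sequence of finite subsets of $[0,1]$, with strictly increasing cardinalities, whose union is dense in $[0,1]$. $\mathrm{PC}^k[0,1]$ is the set of those $u\in\mathrm{PC}[0,1]$ all of whose jumps lie in $X^k$. Let $I_j$ (depending on $k$)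 be the successive intervals into which $X^k$ (together with $0$ and $1$) partitions $[0,1]$. Integral sampling is $S_kf(j)=\frac1{|I_j|}\int_{I_j}f\,d\lambda$ ($\lambda$ Lebesgue measure). Point sampling (for continuous $f$) is $S_kf(j)=f(x_j)$ with a point $x_j\in I_j$, for instance the midpoint of $I_j$. The discrete $L^1$-Potts functional is $$P^k_\gamma(u)=\gamma J(u)+\Big\|u-\sum_j S_kf(j)\,\mathbf 1_{I_j}\Big\|_1\ \text{ if }u\in \mathrm{PC}^k[0,1],\qquad P^k_\gamma(u)=\infty\ \text{ otherwise, for } u\in L^1[0,1].$$ A sequence $F^k:L^1[0,1]\to[0,\infty]$ $\Gamma$-converges to $F^\infty$ if (i) $F^\infty(u)\le\liminf_k F^k(u^k)$ whenever $u^k\to u$ in $L^1[0,1]$, and (ii) for every $u\in L^1[0,1]$ there is a sequence $u^k\to u$ in $L^1[0,1]$ with $F^\infty(u)\ge\limsup_kF^k(u^k)$. An accumulation point of a sequence is the limit of some subsequence. *)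

(* Defs.v *)
From HB Require Import structures.
From mathcomp Require Import all_boot all_order all_algebra finmap.
From mathcomp Require Import all_classical all_reals all_analysis.

Set Implicit Arguments.
Unset Strict Implicit.
Unset Printing Implicit Defensive.

Import Order.TTheory GRing.Theory Num.Theory.
Import numFieldNormedType.Exports.

Local Open Scope classical_set_scope.
Local Open Scope ring_scope.

Section Potts.
Context (R : realType).

Definition mu01 : {measure set (measurableTypeR R) -> \bar R} :=
  mrestr (@lebesgue_measure R) (measurable_itv `[0, 1]).

(* Elements are classes modulo equality a.e. on [0, 1]; they coerce to functions
   R -> R through a chosen representative, whose values outside [0, 1] are
   meaningless, so it may be used only in ways that are invariant under equality
   mu01-almost everywhere. *)
Definition L1 : Type := LspaceType mu01 (lexx 1%E).

Definition L1dist (u g : R -> R) : \bar R := 'N[mu01]_1[EFin \o (u \- g)].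

Definition L1cvg (u_ : nat -> L1) (u : L1) : Prop :=
  L1dist (u_ k) u @[k --> \oo] --> 0%E.

Definition nodes (A : {fset R}) : seq R :=
  sort <=%R (enum_fset (0 |` (1 |` A))%fset).

Definition ncells (A : {fset R}) : nat := (size (nodes A)).-1.

(* The j-th interval of the partition of [0, 1] by A, for j < ncells A. Adjacent
   closed cells overlap at a node, which is harmless in L^1[0, 1]. *)
Definition cell (A : {fset R}) (j : nat) : set R :=
  `[nth 0 (nodes A) j, nth 0 (nodes A) j.+1]%classic.

Definition stepfun (A : {fset R}) (c : nat -> R) : R -> R :=
  fun x => \sum_(j < ncells A) c j * \1_(cell A j) x.

Definition PC (u : L1) : Prop :=
  exists (A : {fset R}) (c : nat -> R),
    [set` A] `<=` `[0, 1]%classic /\ (u : R -> R) = stepfun A c %[ae mu01].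

Definition jumps (u : L1) : set R :=
  [set t | 0 < t < 1 /\ exists a b e : R,
    [/\ a != b, 0 < e,
        (u : R -> R) = cst a %[ae mu01 in `]t - e, t[%classic] &
        (u : R -> R) = cst b %[ae mu01 in `]t, t + e[%classic]]].

Definition J (u : L1) : \bar R := counting (jumps u).

Definition Potts (gamma : R) (f u : L1) : \bar R :=
  if `[< PC u >] then (gamma%:E * J u + L1dist u f)%E else +oo%E.

Definition PCk (A : {fset R}) (u : L1) : Prop :=
  PC u /\ jumps u `<=` [set` A].

(* s : the sampled values of the data, one for each cell of A *)
Definition dPotts (gamma : R) (A : {fset R}) (s : nat -> R) (u : L1) : \bar R :=
  if `[< PCk A u >] then (gamma%:E * J u + L1dist u (stepfun A s))%E
  else +oo%E.

Record discretization_sets (X : nat -> {fset R}) : Prop := {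
  disc_sub : forall k, [set` X k] `<=` `[0, 1]%classic ;
  disc_nested : forall k, (X k `<=` X k.+1)%fset ;
  disc_card : forall k, (#|` X k| < #|` X k.+1|)%N ;
  disc_dense : `[0, 1]%classic `<=` closure (\bigcup_k [set` X k])
}.

Definition integral_sampling (f : L1) (A : {fset R}) (s : nat -> R) : Prop :=
  forall j, (j < ncells A)%N ->
    s j = (fine (lebesgue_measure (cell A j)))^-1 *
          \int[lebesgue_measure]_(x in cell A j) (f x).

Definition point_sampling (g : R -> R) (A : {fset R}) (s : nat -> R) : Prop :=
  forall j, (j < ncells A)%N -> exists2 x, cell A j x & s j = g x.

Definition sampling (f : L1) (X : nat -> {fset R}) (S : nat -> nat -> R) : Prop :=
  (forall k, integral_sampling f (X k) (S k)) \/
  (exists g : R -> R,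
    [/\ {within `[0, 1], continuous g}, (f : R -> R) = g %[ae mu01] &
        forall k, point_sampling g (X k) (S k)]).

Definition Gamma_cvg (F : nat -> L1 -> \bar R) (Foo : L1 -> \bar R) : Prop :=
  (forall (u_ : nat -> L1) (u : L1), L1cvg u_ u ->
     (Foo u <= limn_einf (fun k => F k (u_ k)))%E) /\
  (forall u : L1, exists u_ : nat -> L1, L1cvg u_ u /\
     (limn_esup (fun k => F k (u_ k)) <= Foo u)%E).

Definition minimizer (F : L1 -> \bar R) (u : L1) : Prop :=
  F u = ereal_inf (range F).

Definition accumulation_point (u_ : nat -> L1) (u : L1) : Prop :=
  exists phi : nat -> nat, increasing_seq phi /\ L1cvg (u_ \o phi) u.

End Potts.

(* Main.v *)
(* The jump penalty is handled through a combinatorial description: [u] has more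
   than n jumps (or is not piecewise constant) iff there are n + 1 adjacent
   intervals on each of which [u] is not a.e. constant.  Non-constancy on an
   interval is open in L^1, so J is lower semicontinuous; as the sampled data
   converge to f in L^1, this gives the liminf inequality.  Recovery sequences
   move each jump of the limit to a nearest point of the k-th discretization set.
   Minimizers have boundedly many jumps.  Setting one of their values c_j to 0
   creates no jump, whence |c_j| |I_j| <= 2 \int_(I_j) |f_k| where f_k is the
   sampled datum.  By uniform integrability of (f_k) the pieces that shrink to a
   point vanish in L^1, while on the others the values stay bounded, and
   Bolzano-Weierstrass gives a convergent subsequence.  Limits minimize because
   the Gamma-convergence applies to subsequences of the discretization sets. *)
Require Import Defs.
From HB Require Import structures.
From mathcomp Require Import all_boot all_order all_algebra finmap.
From mathcomp Require Import all_classical all_reals all_analysis.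
From mathcomp Require Import measurable_realfun ring lra.

Set Implicit Arguments.
Unset Strict Implicit.
Unset Printing Implicit Defensive.

Import Order.TTheory GRing.Theory Num.Theory.
Import numFieldNormedType.Exports.

Local Open Scope classical_set_scope.
Local Open Scope ring_scope.

(** * The L1 norm on the unit interval *)

Section L1_norm.
Context {R : realType}.
Local Notation mu := (mu01 R).
Implicit Types (f g h : R -> R) (a b c x : R).

(** The data are merely integrable, so no uniform bound on the values of a minimizer is at hand, and
    bounding the number of jumps alone gives no compactness. Zero is the comparison value because
    its cost on a cell, the integral of |f_k|, depends on the data only; the factor 2 then comes
    from |c| <= |c - f_k| + |f_k|. For the lower bound, jump counts are integers, so it is enough to
    propagate statements n <= J u. Phrased as an implication from [PC u], such a statement holds for
    every n when u is not piecewise constant, and the finite and infinite cases share one estimate.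
    For the upper bound only J u_k <= J u matters, so moved nodes may merge while the discretization
    is still coarse. Elements of L^1 are classes with arbitrary representatives; hence every
    description of a function by constants on intervals is an almost everywhere statement, and is
    made on open intervals so that end points never count. *)

Definition integrable01 h : Prop := mu.-integrable setT (EFin \o h).

(** Real valued, so that estimates become linear arithmetic; on integrable functions [L1distE]
    identifies it with [L1dist]. *)
Definition norm1 h : R := \int[mu]_x `|h x|.

Lemma mu01_le (A : set R) : measurable A -> (mu A <= lebesgue_measure A)%E.
Proof.
move=> mA; rewrite /mu01/= /mrestr le_measure ?inE//; exact: measurableI.
Qed.

Lemma mu01_sub (A : set R) : A `<=` `[0, 1] -> mu A = lebesgue_measure A.
Proof. by move=> A01; rewrite /mu01/= /mrestr; congr (_ _); exact: setIidl. Qed.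

Lemma mu01T : mu setT = 1%E.
Proof.
rewrite /mu01/= /mrestr setTI lebesgue_measure_itv/= lte_fin ltr01.
by rewrite -EFinB subr0.
Qed.

Lemma mu01_finite (A : set R) : measurable A -> (mu A < +oo)%E.
Proof.
move=> mA; apply: (@le_lt_trans _ _ (mu setT)); last by rewrite mu01T ltry.
by rewrite le_measure ?inE.
Qed.

(** Finite sets and the complement of [0, 1] are null for [mu01]. With [s] a list of nodes, claims
    about step functions need checking in open cells only. *)
Lemma ae01 (s : seq R) (P : R -> Prop) :
  (forall x, 0 < x < 1 -> x \notin s -> P x) -> \forall x \ae mu, P x.
Proof.
move=> H; have H2 : mu.-negligible ([set` 0 :: 1 :: s] `|` ~` `[0, 1]).
  apply: negligibleU.
    have cs : countable [set` 0 :: 1 :: s].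
      exact/finite_set_countable/finite_seq.
    have ms : measurable [set` 0 :: 1 :: s].
      by apply: countable_measurable => // t; exact: measurable_set1.
    apply/negligibleP => //; apply/eqP; rewrite -measure_le0.
    by rewrite (le_trans (mu01_le ms))// countable_lebesgue_measure0.
  apply/negligibleP; first exact: measurableC.
  rewrite /mu01/= /mrestr setICl.
  exact: measure0.
apply: negligibleS H2 => x /= nP; apply: contrapT => /not_orP[/= xs].
rewrite !inE in xs; move=> /contrapT; rewrite in_itv/= => /andP[x0 x1].
apply: nP; apply: H.
  rewrite !lt_neqAle x0 x1 !andbT; apply/andP; split; apply: contra_notN xs.
    by move/eqP => <-; rewrite eqxx.
  by move/eqP => ->; rewrite eqxx orbT.
by apply: contra_notN xs => ->; rewrite !orbT.
Qed.

Lemma ae_imp (P Q : R -> Prop) : (forall x, P x -> Q x) ->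
  (\forall x \ae mu, P x) -> \forall x \ae mu, Q x.
Proof.
move=> PQ; apply: negligibleS => x /= nQ; apply: contra_not nQ; exact: PQ.
Qed.

Lemma ae_and (P Q : R -> Prop) : (\forall x \ae mu, P x) ->
  (\forall x \ae mu, Q x) -> \forall x \ae mu, P x /\ Q x.
Proof.
move=> aP aQ; apply: negligibleS (negligibleU aP aQ) => x /= nPQ.
by apply/not_andP.
Qed.

Lemma integrable01_measurable h : integrable01 h -> measurable_fun setT h.
Proof. by move=> /measurable_int/measurable_EFinP. Qed.

Lemma integrable01D f g : integrable01 f -> integrable01 g ->
  integrable01 (f \+ g).
Proof. by move=> hf hg; have := integrableD measurableT hf hg. Qed.

Lemma integrable01B f g : integrable01 f -> integrable01 g ->
  integrable01 (f \- g).
Proof. by move=> hf hg; have := integrableB measurableT hf hg. Qed.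

Lemma integrable01Z c h : integrable01 h -> integrable01 (fun x => c * h x).
Proof. by move=> hh; have := integrableZl measurableT c hh. Qed.

Lemma integrable01_le f h : measurable_fun setT h -> integrable01 f ->
  (forall x, `|h x| <= `|f x|) -> integrable01 h.
Proof.
move=> mh hf hle; apply: le_integrable hf => //; first exact/measurable_EFinP.
by move=> x _ /=; rewrite lee_fin.
Qed.

Lemma integrable01_cst c : integrable01 (cst c).
Proof.
apply: measurable_bounded_integrable => //; first exact: mu01_finite.
exists `|c|; split; first exact: num_real.
by move=> y cy x _ /=; exact: ltW.
Qed.

Lemma integrable01_mul_indic (A : set R) h : measurable A -> integrable01 h ->
  integrable01 (fun x => h x * \1_A x).
Proof.
move=> mA hh; apply: (integrable01_le (f := h)) => //.
  by apply: measurable_funM; [exact: integrable01_measurable|exact: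
    measurable_indic].
move=> x; rewrite normrM indicE; case: (x \in A); rewrite ?normr0 ?normr1 ?mulr0
  ?mulr1//.
Qed.

Lemma integrable01_scale_indic c (A : set R) : measurable A ->
  integrable01 (fun x => c * \1_A x).
Proof. by move=> mA; apply: integrable01_mul_indic => //;
  exact: integrable01_cst. Qed.

Lemma integrable01_indic (A : set R) : measurable A -> integrable01 (\1_A).
Proof.
move=> mA; have := integrable01_scale_indic 1 mA.
by congr integrable01; apply/funext => x; rewrite mul1r.
Qed.

Lemma integrable01_itv a b : integrable01 (\1_`[a, b]).
Proof. by apply: integrable01_indic; exact: measurable_itv. Qed.

Lemma integrable01_sum n (F : nat -> R -> R) : (forall i, (i < n)%N ->
  integrable01 (F i)) ->
  integrable01 (fun x => \sum_(i < n) F i x).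
Proof.
elim: n => [|n IH] H.
  by under eq_fun do rewrite big_ord0; exact: integrable01_cst.
under eq_fun do rewrite big_ord_recr/=.
by apply: integrable01D; [apply: IH => i /ltnW; exact: H|exact: H].
Qed.

Lemma integrable01_norm h : integrable01 h -> integrable01 (fun x => `|h x|).
Proof. by move/integrable_norm. Qed.

Lemma norm1E h : integrable01 h -> (\int[mu]_x `|(h x)%:E|)%E = (norm1 h)%:E.
Proof.
move=> hh; rewrite /norm1 /Rintegral fineK//.
exact: (integrable_fin_num measurableT (integrable01_norm hh)).
Qed.

Lemma norm1_ge0 h : 0 <= norm1 h.
Proof. exact: Rintegral_ge0. Qed.

(** The common source of monotonicity, the triangle inequality and the later splittings: only
    absolute values almost everywhere enter. *)
Lemma norm1_le_add h f g : integrable01 h -> integrable01 f -> integrable01 g ->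
  (\forall x \ae mu, `|h x| <= `|f x| + `|g x|) -> norm1 h <= norm1 f + norm1 g.
Proof.
move=> hh hf hg hle; rewrite -RintegralD//; [|exact: integrable01_norm..].
rewrite /norm1 /Rintegral fine_le//.
- exact: (integrable_fin_num measurableT (integrable01_norm hh)).
- exact: (integrable_fin_num measurableT (integrable01D (integrable01_norm hf)
  (integrable01_norm hg))).
apply: ae_ge0_le_integral => //.
- by apply/measurable_EFinP; exact: integrable01_measurable (integrable01_norm
  hh).
- by apply/measurable_EFinP; exact: integrable01_measurable (integrable01D
  (integrable01_norm hf) (integrable01_norm hg)).
by apply: (ae_imp _ hle) => x ? _; rewrite lee_fin.
Qed.

Lemma norm1_0 : norm1 (cst 0) = 0.
Proof.
by rewrite /norm1/=; under eq_Rintegral do rewrite normr0;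
  rewrite Rintegral_cst// mul0r.
Qed.

Lemma norm1_le h f : integrable01 h -> integrable01 f ->
  (\forall x \ae mu, `|h x| <= `|f x|) -> norm1 h <= norm1 f.
Proof.
move=> hh hf hle; rewrite -[leRHS]addr0 -norm1_0; apply: norm1_le_add => //.
  exact: integrable01_cst.
by apply: (ae_imp _ hle) => x; rewrite normr0 addr0.
Qed.

Lemma ae_eq_norm1 h f : integrable01 h -> integrable01 f -> h = f %[ae mu] ->
  norm1 h = norm1 f.
Proof.
move=> hh hf hle; apply/eqP; rewrite eq_le.
by apply/andP; split; apply: norm1_le => //; apply: (ae_imp _ hle) =>
  x /(_ I) ->.
Qed.

Lemma norm1D f g : integrable01 f -> integrable01 g ->
  norm1 (f \+ g) <= norm1 f + norm1 g.
Proof.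
move=> hf hg; apply: norm1_le_add => //; first exact: integrable01D.
by apply: aeW => x /=; exact: ler_normD.
Qed.

Lemma norm1Z c h : integrable01 h -> norm1 (fun x => c * h x) = `|c| * norm1 h.
Proof.
move=> hh; rewrite /norm1 -RintegralZl//; last exact: integrable01_norm.
by apply: eq_Rintegral => x _; rewrite normrM.
Qed.

Lemma norm1_distC f g : norm1 (f \- g) = norm1 (g \- f).
Proof. by apply: eq_Rintegral => x _ /=; rewrite distrC. Qed.

Lemma norm1_distD f g h : integrable01 f -> integrable01 g -> integrable01 h ->
  norm1 (f \- h) <= norm1 (f \- g) + norm1 (g \- h).
Proof.
move=> hf hg hh; apply: norm1_le_add; [exact: integrable01B..|].
apply: aeW => x /=; exact: ler_distD.
Qed.

Lemma norm1_eq0 h : integrable01 h -> norm1 h = 0 -> h = 0 %[ae mu].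
Proof.
move=> hh h0; have := ae_eq_integral_abs mu measurableT (measurable_int _ hh).
rewrite /= (norm1E hh) h0 => -[/(_ erefl) + _].
by apply: ae_imp => x /(_ I)/= [->].
Qed.

Lemma norm1_sum n (F : nat -> R -> R) : (forall i, (i < n)%N ->
  integrable01 (F i)) ->
  norm1 (fun x => \sum_(i < n) F i x) <= \sum_(i < n) norm1 (F i).
Proof.
elim: n => [|n IH] H.
  rewrite big_ord0; under eq_fun do rewrite big_ord0.
  by rewrite -/(cst 0) norm1_0.
under eq_fun do rewrite big_ord_recr/=.
rewrite big_ord_recr/=; apply: le_trans.
  apply: (norm1D (f := fun x => \sum_(i < n) F i x)); last exact: H.
  by apply: integrable01_sum => i /ltnW; exact: H.
by rewrite lerD2r; apply: IH => i /ltnW; exact: H.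
Qed.

Lemma norm1_indic a b : 0 <= a -> a <= b -> b <= 1 ->
  norm1 (\1_`[a, b]) = b - a.
Proof.
move=> a0 ab b1; rewrite /norm1.
under eq_Rintegral do rewrite ger0_norm//.
rewrite /Rintegral integral_indic// setIT mu01_sub.
  rewrite lebesgue_measure_itv/= lte_fin; case: ltP => // ba.
  by rewrite (le_anti (introT andP (conj ba ab))) subrr.
move=> x /=; rewrite !in_itv/= => /andP[ax xb].
by rewrite (le_trans a0 ax) (le_trans xb b1).
Qed.

Lemma L1distE f g : integrable01 f -> integrable01 g ->
  L1dist f g = (norm1 (f \- g))%:E.
Proof. by move=> hf hg; rewrite /L1dist Lnorm1 -norm1E//;
  exact: integrable01B. Qed.

Lemma Rintegral_cell f a b : integrable01 f -> 0 <= a -> b <= 1 ->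
  \int[lebesgue_measure]_(x in `[a, b]) f x = \int[mu]_x (f x * \1_`[a, b] x).
Proof.
move=> hf a0 b1.
transitivity (\int[mu]_(x in `[a, b]) f x).
  congr fine; apply: eq_measure_integral => A mA Aab.
  rewrite mu01_sub// => x /Aab/=; rewrite !in_itv/= => /andP[ax xb].
  by rewrite (le_trans a0 ax) (le_trans xb b1).
rewrite Rintegral_mkcond; apply: eq_Rintegral => x _.
rewrite patchE indicE; case: (x \in _); by rewrite ?mulr1 ?mulr0.
Qed.

Lemma L1_integrable01 (u : L1 R) : integrable01 u.
Proof.
apply/Lfun1_integrable; rewrite inE; apply/andP; split; rewrite inE/=.
  exact: (@measurable_funPT _ _ _ _ (repr (LebesgueSpace.sort u))).
exact: Lebesgue_finite.
Qed.

(** The coercion of a class returns a chosen representative, so [h] is recovered only up to a null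
    set. Finiteness of the norm is transferred to that representative through the almost everywhere
    equality. *)
Lemma L1_exists h : integrable01 h -> exists u : L1 R, (u : R ->
  R) = h %[ae mu].
Proof.
move=> hh.
pose m : {mfun measurableTypeR R >-> measurableTypeR R} :=
  @mfun_Sub _ _ (measurableTypeR R) (measurableTypeR R) h (mem_set
    (integrable01_measurable hh)).
pose q : {mfun_ mu, measurableTypeR R >-> measurableTypeR R} := \pi%qT m.
have qh : (q : R -> R) = h %[ae mu].
  by have /eqP := reprK q; rewrite {2}/q eqmodE => /asboolP.
have fq : finite_norm mu 1 q.
  rewrite /finite_norm Lnorm1.
  have /integrableP[_] := hh; congr (_ < _)%E.
  apply: ge0_ae_eq_integral => //.
  - by apply/measurableT_comp => //; exact: measurable_int hh.
  - apply/measurableT_comp => //; apply/measurable_EFinP.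
    exact: (@measurable_funPT _ _ _ _ (repr q)).
  - by apply: (ae_imp _ qh) => x /= /[apply] ->.
pose Q := isFinLebesgue.Build _ _ _ mu 1%E (lexx 1%E) q fq.
by exists (HB.pack q Q : L1 R).
Qed.

End L1_norm.

(** * Almost everywhere constant pieces *)

Section piecewise_constant.
Context {R : realType}.
Local Notation mu := (mu01 R).
Implicit Types (u v : R -> R) (a b c d t x : R) (T : set R).

Definition ae_cst u a b : Prop := exists p, u = cst p %[ae mu in `]a,
  b[%classic].

(** Says that inside ]a, b[ the function can jump only at points of [T]. Quantifying over intervals
    free of [T] makes sense for any set [T], including [jumps u] before its finiteness is known, and
    is monotone in [T]. *)
Definition ae_cst_off T a b u : Prop := forall c d, a <= c -> c < d -> d <= b ->
  (forall t, T t -> ~ c < t < d) -> ae_cst u c d.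

Lemma ae_cst_sub u a b c d : a <= c -> d <= b -> ae_cst u a b -> ae_cst u c d.
Proof.
move=> ac db [p up]; exists p; apply: (ae_imp _ up) => x + /= xcd; apply.
move: xcd => /=; rewrite !in_itv/= => /andP[cx xd].
by rewrite (le_lt_trans ac cx) (lt_le_trans xd db).
Qed.

Lemma ae_itv_ex a b (P : R -> Prop) : 0 <= a -> a < b -> b <= 1 ->
  (\forall x \ae mu, `]a, b[%classic x -> P x) -> exists2 x, a < x < b & P x.
Proof.
move=> a0 ab b1 aeP; apply: contrapT => nP.
have : mu.-negligible `]a, b[%classic.
  apply: negligibleS aeP => x /= xab xP; apply: nP.
  by exists x; [move: xab; rewrite in_itv|exact: xP].
have mI : measurable (`]a, b[%classic : set R) by exact: measurable_itv.
move=> n0; have : mu `]a, b[%classic = 0%E.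
  by have [+ _] := negligibleP mu mI; apply.
rewrite mu01_sub; last first.
  move=> x /=; rewrite !in_itv/= => /andP[ax xb].
  by rewrite (le_trans a0 (ltW ax)) (le_trans (ltW xb) b1).
rewrite lebesgue_measure_itv/= lte_fin ab => /eqP.
by rewrite -EFinB eqe subr_eq0 gt_eqF.
Qed.

Lemma cst_uniq u a b p q : 0 <= a -> a < b -> b <= 1 ->
  u = cst p %[ae mu in `]a, b[%classic] -> u = cst q %[ae mu in `]a, b[%classic]
    -> p = q.
Proof.
move=> a0 ab b1 up uq.
have : \forall x \ae mu, `]a, b[%classic x -> p = q.
  apply: (ae_imp _ (ae_and up uq)) => x /= [xp xq] xI.
  by rewrite -(xp xI) (xq xI).
by move=> /(ae_itv_ex a0 ab b1)[].
Qed.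

(** Exhaust ]a, b[ by countably many nested intervals; their constants agree because the smallest
    one has positive measure. *)
Lemma ae_cst_inner u a b : 0 <= a -> b <= 1 ->
  (forall c d, a < c -> c < d -> d < b -> ae_cst u c d) -> ae_cst u a b.
Proof.
move=> a0 b1 H; have [ab|ba] := ltP a b; last first.
  exists 0; apply: aeW => x /=; rewrite in_itv/= => /andP[ax xb].
  by have := lt_le_trans (lt_trans ax xb) ba; rewrite ltxx.
(* A denominator of at least 3 gives 2 e_n < b - a, so even the first inner interval is nonempty. *)
pose e n : R := (b - a) / n.+3%:R.
have e0 n : 0 < e n by rewrite divr_gt0// subr_gt0.
have eE n : e n * n.+3%:R = b - a by rewrite mulfVK// pnatr_eq0.
have e2 n : e n * 2 < b - a by rewrite -(eE n) ltr_pM2l// ltr_nat.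
have enn m n : (m <= n)%N -> e n <= e m.
  move=> mn; rewrite ler_pM2l ?subr_gt0// lef_pV2 ?posrE//.
  by rewrite ler_nat !ltnS.
have /choice[p Hp] : forall n, exists p,
    u = cst p %[ae mu in `](a + e n), (b - e n)[%classic].
  move=> n; have [|||p Hp] := H (a + e n) (b - e n).
  - by rewrite ltrDl.
  - by have := e2 n; lra.
  - by rewrite ltrBlDr ltrDl.
  by exists p.
have pE n : p n = p 0%N.
  have h0 := enn _ _ (leq0n n).
  apply: (@cst_uniq u (a + e 0%N) (b - e 0%N)) => //.
  - by have := e0 0%N; lra.
  - by have := e2 0%N; lra.
  - by have := e0 0%N; lra.
  - apply: (ae_imp _ (Hp n)) => x + /= xI; apply.
    by move: xI; rewrite /= !in_itv/= => /andP[? ?]; apply/andP; split; lra.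
exists (p 0%N); have := ae_foralln Hp.
apply: ae_imp => x Hx /=; rewrite in_itv/= => /andP[ax xb].
pose m := Num.min (x - a) (b - x).
have m0 : 0 < m by rewrite lt_min !subr_gt0 ax xb.
have [n Hn] : exists n, e n < m.
  pose n := Num.bound ((b - a) / m); exists n.
  have : (b - a) / m < n%:R by apply: archi_boundP;
    rewrite ltW// divr_gt0// subr_gt0.
  rewrite /e !ltr_pdivrMr// => h; apply: (lt_le_trans h).
  by rewrite mulrC ler_pM2l// ler_nat -addn3 leq_addr.
move: Hn; rewrite lt_min => /andP[n1 n2].
rewrite (Hx n) ?pE//= in_itv/=; apply/andP; split; lra.
Qed.

Lemma ae_cst_off_sub T T' a b u : T `<=` T' -> ae_cst_off T a b u ->
  ae_cst_off T' a b u.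
Proof.
by move=> TT' H c d ac cd db nT; apply: H => // t /TT'; exact: nT.
Qed.

Lemma ae_eq_ae_cst_off T a b u v : u = v %[ae mu] -> ae_cst_off T a b v ->
  ae_cst_off T a b u.
Proof.
move=> uv H c d ac cd db nT; have [p vp] := H c d ac cd db nT; exists p.
by apply: (ae_imp _ (ae_and uv vp)) => x [/(_ I)/= ->].
Qed.

(** A certificate for at least n jumps: cut points a < x_1 < ... < x_n <= b with u not constant
    between neighbours. Nothing is required to the right of x_n. *)
Fixpoint adjacent_nonconst n a b u : Prop :=
  if n is m.+1 then
    exists x, [/\ a < x, x <= b, ~ ae_cst u a x & adjacent_nonconst m x b u]
  else True.

(** Each interval of the chain must contain a point of [s] in its interior. Once used, this point
    can be removed from [s], since the remaining intervals lie to its right. *)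
Lemma ae_cst_off_nonconst_le n (s : seq R) a b u :
  ae_cst_off [set` s] a b u -> adjacent_nonconst n a b u -> (n <= size s)%N.
Proof.
elim: n a s => [//|n IH] a s H /= [x [ax xb ncst alt]].
have [t ts /andP[at_ tx]] : exists2 t, t \in s & a < t < x.
  apply: contrapT => nt; apply: ncst; apply: H => // t ts atx.
  by apply: nt; exists t.
have : (n <= size (rem t s))%N.
  apply: (IH x) => // c d xc cd db nT; apply: H => //.
    exact: le_trans (ltW ax) xc.
  move=> y /= ys /andP[cy yd].
  have [yt|yt] := eqVneq y t.
    by move: (lt_trans (lt_le_trans tx xc) cy); rewrite yt ltxx.
  apply: (nT y) => /=; last by rewrite cy.
  by have := perm_mem (perm_to_rem ts) y; rewrite ys inE (negbTE yt) /= => <-.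
rewrite size_rem//; case: s ts {H} => //=.
Qed.

(** Greedy construction of the jump points: the next one is the supremum t of the points up to which
    u stays constant, and the part right of t admits one interval less. *)
Lemma nonconst_le_ae_cst_off n a b u : 0 <= a -> a <= b -> b <= 1 ->
  ~ adjacent_nonconst n.+1 a b u ->
  exists2 s : seq R, (size s <= n)%N & ae_cst_off [set` s] a b u.
Proof.
elim: n a => [|n IH] a a0 ab b1 nalt.
  exists [::] => //; have Hab : ae_cst u a b.
    move: ab; rewrite le_eqVlt => /predU1P[<-|ab].
      exists 0; apply: aeW => x /=; rewrite in_itv/= => /andP[ax xb].
      by have := lt_trans ax xb; rewrite ltxx.
    by apply: contrapT => nc; apply: nalt; exists b.
  by move=> c d ac _ db _; exact: ae_cst_sub Hab.
pose E : set R := [set x | a <= x <= b /\ ae_cst u a x].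
have Ea : E a.
  split; first by rewrite lexx.
  exists 0; apply: aeW => x /=; rewrite in_itv/= => /andP[ax xb].
  by have := lt_trans ax xb; rewrite ltxx.
have supE : has_sup E by split; [exists a|exists b => x [/andP[]]].
pose t := sup E.
have at_ : a <= t by apply: ub_le_sup => //; exact: supE.2.
have tb : t <= b by apply: ge_sup; [exists a|move=> x [/andP[]]].
have Eat : ae_cst u a t.
  apply: ae_cst_inner => //; first exact: le_trans b1.
  move=> c d ac cd dt.
  have [|y [_ Ey] dy] := @sup_adherent R E (t - d) _ supE;
    first by rewrite subr_gt0.
  apply: ae_cst_sub Ey; first exact: ltW.
  by move: dy; rewrite -/t; lra.
have [|s ss Hs] := IH t (le_trans a0 at_) tb b1.
  move=> [y [ty yb ncst alt]].
  (* The first interval of a chain starting at t is shrunk to begin at some x > t. As x exceeds the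
     supremum, u is not constant on ]a, x[ either, and prepending this interval gives a chain that
     is too long. *)
  have [x [tx xy nc]] : exists x, [/\ t < x, x < y & ~ ae_cst u x y].
    apply: contrapT => nx; apply: ncst; apply: ae_cst_inner.
    - exact: le_trans at_.
    - exact: le_trans b1.
    move=> c d tc cd dy; apply: contrapT => ncd.
    apply: nx; exists c; split => //; first exact: lt_trans dy.
    by apply: contra_not ncd; apply: ae_cst_sub => //; exact: ltW.
  apply: nalt; exists x; split.
  - exact: le_lt_trans tx.
  - exact: le_trans (ltW xy) yb.
  - move=> cax; have : x <= t.
      apply: ub_le_sup; first exact: supE.2.
      split => //; rewrite (le_trans (ltW xy) yb) andbT.
      exact: le_trans (ltW tx).
    by rewrite leNgt tx.
  - by exists y.
exists (t :: s) => // c d ac cd db nT.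
have [dt|td] := leP d t; first exact: ae_cst_sub Eat.
have [ct|tc] := ltP c t.
  by exfalso; apply: (nT t) => /=; [rewrite inE eqxx|rewrite ct].
by apply: Hs => // y ys; apply: nT => /=; rewrite inE; apply/orP; right.
Qed.

Lemma increasing_seq_ge (phi : nat -> nat) n : increasing_seq phi ->
  (n <= phi n)%N.
Proof.
move=> /increasing_seqP incr; elim: n => // n IH.
by apply: leq_ltn_trans IH _; exact: incr.
Qed.

(** On an interval of positive length, constants that are close to u in L^1 are close to each other.
    They have a limit along a subsequence, and u equals that limit. *)
Lemma ae_cst_closed u a b : integrable01 u -> 0 <= a -> b <= 1 ->
  (forall e, 0 < e -> exists p, norm1 (fun x => (u x - p) * \1_`[a, b] x) < e)
    ->
  ae_cst u a b.
Proof.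
move=> hu a0 b1 H; have [ab|ba] := ltP a b; last first.
  exists 0; apply: aeW => x /=; rewrite in_itv/= => /andP[ax xb].
  by have := lt_le_trans (lt_trans ax xb) ba; rewrite ltxx.
pose h p x := (u x - p) * \1_`[a, b] x.
have hI p : integrable01 (h p).
  by apply: integrable01_mul_indic => //; apply: integrable01B => //;
    exact: integrable01_cst.
have hc p : integrable01 (fun x => p * \1_`[a, b] x) by exact:
  integrable01_scale_indic.
have nc p : norm1 (fun x => p * \1_`[a, b] x) = `|p| * (b - a).
  by rewrite norm1Z; [rewrite norm1_indic// ltW|exact: integrable01_itv].
have /choice[p Hp] : forall n : nat, exists p, norm1 (h p) < n.+1%:R^-1.
  by move=> n; exact: H.
have ba0 : 0 < b - a by rewrite subr_gt0.
have dist q r : `|q - r| * (b - a) <= norm1 (h q) + norm1 (h r).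
  rewrite -nc; apply: norm1_le_add => //; apply: aeW => x; rewrite /h.
  have -> : (q - r) * \1_`[a, b] x =
      (u x - r) * \1_`[a, b] x - (u x - q) * \1_`[a, b] x by ring.
  by rewrite distrC; exact: ler_normB.
have [phi phi_incr pl] : exists2 f : nat -> nat, increasing_seq f & cvgn (p \o
  f).
  (* Both [h (p n)] and [h (p 0)] have norm below 1, so |p n - p 0| times b - a is at most 2. *)
  apply: bolzano_weierstrass; exists (`|p 0%N| + 2 / (b - a)).
  split; first exact: num_real.
  move=> y /ltW My n _; apply: le_trans My.
  rewrite -lerBlDl; apply: le_trans (lerB_dist _ _) _.
  rewrite ler_pdivlMr//; apply: le_trans (dist _ _) _.
  have := Hp n; have := Hp 0%N; rewrite invr1.
  have : n.+1%:R^-1 <= 1 :> R by rewrite invf_le1// ler1n.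
  move=> h1 h2 h3; apply: (le_trans (lerD (ltW (lt_le_trans h3 h1)) (ltW h2))).
  by rewrite -mulr2n.
set l := limn (p \o phi) in pl.
have hl0 : norm1 (h l) = 0.
  apply/eqP; rewrite eq_le norm1_ge0 andbT; apply/ler_addgt0Pl => e e0;
    rewrite addr0.
  have e20 : 0 < e / 2 by rewrite divr_gt0.
  have [N _ HN] : \forall n \near \oo, n.+1%:R^-1 < e / 2 :> R.
    exact: near_infty_natSinv_lt (PosNum e20).
  have /cvgrPdist_lt/(_ _ (divr_gt0 e20 ba0))[M _ HM] := pl.
  pose n := maxn N M.
  have h1 : norm1 (h (p (phi n))) < e / 2.
    apply: lt_trans (Hp _) _; apply: HN => /=.
    exact: leq_trans (leq_maxl _ _) (increasing_seq_ge n phi_incr).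
  have h2 : `|l - p (phi n)| * (b - a) < e / 2.
    by rewrite -ltr_pdivlMr//; apply: HM; exact: leq_maxr.
  have : norm1 (h l) <= norm1 (h (p (phi n))) + `|l - p (phi n)| * (b - a).
    rewrite -nc; apply: norm1_le_add => //; apply: aeW => x; rewrite /h.
    have -> : (u x - l) * \1_`[a, b] x =
      (u x - p (phi n)) * \1_`[a, b] x - (l - p (phi n)) * \1_`[a, b] x by ring.
    exact: ler_normB.
  by lra.
exists l; apply: ae_imp (norm1_eq0 (hI l) hl0) => x /(_ I)/= + xI.
rewrite /h indicE mem_set ?mulr1.
  by move/eqP; rewrite subr_eq0 => /eqP.
by move: xI; rewrite /= !in_itv/= => /andP[/ltW -> /ltW ->].
Qed.

(** Contrapositive of closedness: functions constant on ]a, b[ and arbitrarily close to u supply the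
    approximating constants. *)
Lemma nonconst_open u a b : integrable01 u -> 0 <= a -> b <= 1 ->
  ~ ae_cst u a b ->
  exists2 e, 0 < e & forall v, integrable01 v -> norm1 (v \- u) < e ->
    ~ ae_cst v a b.
Proof.
move=> hu a0 b1 nu; apply: contrapT => ne; apply: nu.
apply: ae_cst_closed => // e e0.
apply: contrapT => np; apply: ne; exists e => // v hv vu [p vp].
apply: np; exists p; apply: le_lt_trans vu.
apply: norm1_le; [|exact: integrable01B|].
  by apply: integrable01_mul_indic => //; apply: integrable01B => //;
    exact: integrable01_cst.
(* The indicator is that of the closed interval, while v is known on the open one only. *)
have ab : \forall x \ae mu, x != a /\ x != b.
  by apply: (@ae01 _ [:: a; b]) => x _; rewrite !inE negb_or => /andP.
apply: (ae_imp _ (ae_and vp ab)) => x /= [vpx [xa xb]].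
rewrite indicE; have [|_] := boolP (x \in _); last by rewrite mulr0 normr0.
rewrite inE/= in_itv/= => /andP[ax bx]; rewrite mulr1 vpx.
  by rewrite distrC.
by rewrite /= in_itv/= !lt_neqAle ax bx eq_sym xa xb.
Qed.

Lemma adjacent_nonconst_open n u a b : integrable01 u -> 0 <= a -> b <= 1 ->
  adjacent_nonconst n a b u ->
  exists2 e, 0 < e & forall v, integrable01 v -> norm1 (v \- u) < e ->
    adjacent_nonconst n a b v.
Proof.
move=> hu; elim: n a => [|n IH] a a0 b1; first by exists 1.
move=> [x [ax xb nc alt]].
have [e e0 He] := nonconst_open hu a0 (le_trans xb b1) nc.
have [d d0 Hd] := IH x (le_trans a0 (ltW ax)) b1 alt.
exists (Num.min e d); first by rewrite lt_min e0.
move=> v hv; rewrite lt_min => /andP[ve vd].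
by exists x; split => //; [exact: He|exact: Hd].
Qed.

End piecewise_constant.

(** * Jumps and step functions *)

Section step_functions.
Context {R : realType}.
Local Notation mu := (mu01 R).
Implicit Types (a b c d t x : R) (T : set R) (s : seq R) (A B : {fset R}).

Lemma seq_isolated s t : exists2 e, 0 < e & forall x, x \in s -> x != t ->
  e <= `|x - t|.
Proof.
elim: s => [|y s [e e0 He]]; first by exists 1.
have [->|yt] := eqVneq y t.
  by exists e => // x; rewrite inE => /predU1P[->|/He//]; rewrite eqxx.
exists (Num.min e `|y - t|); first by rewrite lt_min e0 normr_gt0 subr_eq0.
move=> x; rewrite inE => /predU1P[-> _|/He/[apply] ex].
  by rewrite ge_min lexx orbT.
by rewrite ge_min ex.
Qed.

Lemma jumps_sub s (u : L1 R) : ae_cst_off [set` s] 0 1 u ->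
  jumps u `<=` [set` s].
Proof.
move=> H t [/andP[t0 t1]] [a [b [e [ab e0 ua ub]]]]; apply: contrapT => /= ts.
have [d d0 Hd] := seq_isolated s t.
(* The radius keeps ]t - r, t + r[ inside [0, 1], inside the range of both one-sided constants, and
   free of points of [s]. A single constant then holds on both sides, so a = b. *)
pose r := Num.min (Num.min e d) (Num.min t (1 - t)).
have r0 : 0 < r by rewrite !lt_min e0 d0 t0 subr_gt0 t1.
have [re rd rt r1] : [/\ r <= e, r <= d, r <= t & r <= 1 - t].
  by rewrite /r !ge_min !lexx !orbT.
clearbody r.
have [p up] : ae_cst u (t - r) (t + r).
  apply: H; [lra|lra|lra|].
  move=> x xs /andP[x1 x2].
  have xt : x != t by apply: contra_notN ts => /eqP <-.
  have := Hd x xs xt; rewrite leNgt => /negP; apply.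
  by apply: lt_le_trans rd; rewrite ltr_norml; lra.
have ap : a = p.
  apply: (@cst_uniq _ u (t - r) t); [lra|lra|lra| |].
    apply: ae_imp ua => x + /= xI; apply; move: xI => /=.
    by rewrite !in_itv/= => /andP[? ->]; rewrite andbT; lra.
  apply: ae_imp up => x + /= xI; apply; move: xI => /=.
  by rewrite !in_itv/= => /andP[-> ?]/=; lra.
have bp : b = p.
  apply: (@cst_uniq _ u t (t + r)); [lra|lra|lra| |].
    apply: ae_imp ub => x + /= xI; apply; move: xI => /=.
    by rewrite !in_itv/= => /andP[-> ?]/=; lra.
  apply: ae_imp up => x + /= xI; apply; move: xI => /=.
  by rewrite !in_itv/= => /andP[? ->]; rewrite andbT; lra.
by rewrite ap bp eqxx in ab.
Qed.

(** Left and right of t the function has constants p and q. If they differed, t would be a jump; if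
    they agree, the null set {t} can be filled in. *)
Lemma ae_cst_off_remove T t (u : L1 R) : ae_cst_off (T `|` [set t]) 0 1 u ->
  ~ jumps u t ->
  ae_cst_off T 0 1 u.
Proof.
move=> H nj c d c0 cd d1 nT.
have [/andP[ct td]|ntcd] := boolP (c < t < d); last first.
  apply: H => // x [Tx|/= ->]; first exact: nT.
  exact/negP.
have [p up] : ae_cst u c t.
  apply: H; [by []|by []|lra|] => x [Tx|/= ->]; last by rewrite ltxx andbF.
  by move=> /andP[cx xt]; apply: (nT x Tx); rewrite cx (lt_trans xt td).
have [q uq] : ae_cst u t d.
  apply: H; [lra|by []|by []|] => x [Tx|/= ->]; last by rewrite ltxx.
  by move=> /andP[tx xd]; apply: (nT x Tx); rewrite xd (lt_trans ct tx).
have [pq|pq] := eqVneq p q; last first.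
  exfalso; apply: nj; split; first lra.
  pose e := Num.min (t - c) (d - t).
  have [ec ed] : e <= t - c /\ e <= d - t by rewrite !ge_min !lexx !orbT.
  exists p, q, e; split => //; first by rewrite lt_min !subr_gt0 ct td.
    apply: ae_imp up => x + /= xI; apply; move: xI => /=.
    by rewrite !in_itv/= => /andP[? ->]; rewrite andbT; lra.
  apply: ae_imp uq => x + /= xI; apply; move: xI => /=.
  by rewrite !in_itv/= => /andP[-> ?]/=; lra.
exists p; have tt : \forall x \ae mu, x != t.
  by apply: (@ae01 _ [:: t]) => x _; rewrite !inE.
apply: (ae_imp _ (ae_and tt (ae_and up uq))) => x /= [xt [h1 h2]].
rewrite in_itv/= => /andP[cx xd]; have [tx|xlt|xe] := ltgtP t x.
- by rewrite pq h2//= in_itv/= tx.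
- by rewrite h1//= in_itv/= cx.
- by rewrite xe eqxx in xt.
Qed.

(** Adjoin the jumps first, then discard the points of [s] one by one: each of them is either a
    jump, hence redundant, or removable. *)
Lemma ae_cst_off_jumps s (u : L1 R) : ae_cst_off [set` s] 0 1 u ->
  ae_cst_off (jumps u) 0 1 u.
Proof.
move=> H; have {H} : ae_cst_off (jumps u `|` [set` s]) 0 1 u.
  by apply: ae_cst_off_sub H; exact: subsetUr.
elim: s => [|t s IH]; first by apply: ae_cst_off_sub => x [].
move=> H; apply: IH; have [jt|nj] := pselect (jumps u t).
  apply: ae_cst_off_sub H => x [jx|/=]; first by left.
  by rewrite inE => /predU1P[->|xs]; [left|right].
apply: (@ae_cst_off_remove _ t) => //; apply: ae_cst_off_sub H => x [jx|/=].
  by left; left.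
by rewrite inE => /predU1P[->|xs]; [right|left; right].
Qed.

Lemma J_fset B (u : L1 R) : [set` B] = jumps u -> J u = (#|` B|%:R)%:E.
Proof.
move=> BE; rewrite /J /counting -BE asboolT; last exact: finite_fset.
by rewrite set_fsetK.
Qed.

Lemma J_le B (u : L1 R) : jumps u `<=` [set` B] -> (J u <= (#|` B|%:R)%:E)%E.
Proof.
move=> uB; have fj : finite_set (jumps u).
  exact: sub_finite_set uB (finite_fset B).
rewrite /J /counting asboolT// lee_fin ler_nat; apply: fsubset_leq_card.
by rewrite -(set_fsetK B) -fset_set_sub//; exact: finite_fset.
Qed.

(** * Nodes, cells and the values of a step function *)

Lemma mem_nodes A x : (x \in nodes A) = [|| x == 0, x == 1 | x \in A].
Proof. by rewrite mem_sort; rewrite !inE. Qed.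

Lemma nodes01 A x : [set` A] `<=` `[0, 1]%classic -> x \in nodes A ->
  0 <= x <= 1.
Proof.
move=> A01; rewrite mem_nodes => /or3P[/eqP->|/eqP->|xA].
- by rewrite lexx ler01.
- by rewrite lexx ler01.
- by have := A01 x xA; rewrite /= in_itv.
Qed.

Lemma nodes_sorted A : sorted <%R (nodes A).
Proof.
by rewrite sort_lt_sorted; exact: fset_uniq.
Qed.

Lemma ncells_gt0 A : (0 < ncells A)%N.
Proof.
have /uniq_leq_size : {subset [:: 0; 1] <= nodes A}.
  by move=> x; rewrite mem_nodes !inE => /orP[] /eqP ->; rewrite eqxx ?orbT.
rewrite /= !inE eq_sym oner_neq0 => /(_ erefl).
by rewrite /ncells; case: (size _) => [|[]].
Qed.

Lemma ncells_le A : (ncells A <= #|` A|.+1)%N.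
Proof.
rewrite /ncells size_sort -[size _]/(#|` _|) !cardfsU1.
by case: (_ \notin _); case: (_ \notin _); rewrite /= ?leqnSn// (leq_trans
  (leq_pred _)).
Qed.

Lemma size_nodes A : size (nodes A) = (ncells A).+1.
Proof. by rewrite /ncells prednK//; have := ncells_gt0 A; rewrite /ncells;
  case: size. Qed.

Lemma nth_nodes A j : (j <= ncells A)%N -> nth 0 (nodes A) j \in nodes A.
Proof. by move=> jA; rewrite mem_nth// size_nodes ltnS. Qed.

Lemma nodes_lt A i j : (i < j)%N -> (j <= ncells A)%N ->
  nth 0 (nodes A) i < nth 0 (nodes A) j.
Proof.
move=> ij jA; rewrite (lt_sorted_ltn_nth 0 (nodes_sorted A))// inE size_nodes
  ltnS//.
exact: leq_trans (ltnW ij) jA.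
Qed.

Lemma nodes_le A i j : (i <= j)%N -> (j <= ncells A)%N ->
  nth 0 (nodes A) i <= nth 0 (nodes A) j.
Proof.
by rewrite leq_eqVlt => /predU1P[->//|ij jA]; exact/ltW/nodes_lt.
Qed.

Section in_unit_interval.
Variable (A : {fset R}).
Hypothesis A01 : [set` A] `<=` `[0, 1]%classic.

Lemma nth_nodes01 j : (j <= ncells A)%N -> 0 <= nth 0 (nodes A) j <= 1.
Proof. by move=> jA; apply: (nodes01 A01); exact: nth_nodes. Qed.

Lemma cell_between j t : (j < ncells A)%N -> t \in nodes A ->
  ~ nth 0 (nodes A) j < t < nth 0 (nodes A) j.+1.
Proof.
move=> jA /(nthP 0)[i]; rewrite size_nodes ltnS => iA <- /andP[ji ij].
have [ij'|ji'] := leqP i j.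
  by move: ji; rewrite ltNge nodes_le// ltnW.
by move: ij; rewrite ltNge nodes_le.
Qed.

Lemma locate_cell x : 0 < x < 1 -> x \notin nodes A ->
  exists2 j, (j < ncells A)%N & nth 0 (nodes A) j < x < nth 0 (nodes A) j.+1.
Proof.
move=> /andP[x0 x1] xn.
have hx : has (fun y => x < y) (nodes A).
  by apply/hasP; exists 1 => //; rewrite mem_nodes eqxx orbT.
have := nth_find 0 hx; have := hx; rewrite has_find size_nodes ltnS => kA.
set k := find _ _ in kA *; case kE : k kA => [|j] jA /= xk.
  have /(nthP 0)[i] : 0 \in nodes A by rewrite mem_nodes eqxx.
  rewrite size_nodes ltnS => iA i0; have := nodes_le (leq0n i) iA.
  by rewrite i0 => /(lt_le_trans xk)/(lt_trans x0); rewrite ltxx.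
exists j => //; rewrite xk andbT lt_neqAle; apply/andP; split.
  by apply: contraNneq xn => <-; apply: nth_nodes; exact: ltnW.
have /(before_find 0)/negbT : (j < k)%N by rewrite kE.
by rewrite -leNgt.
Qed.

(** Strict inequalities matter: at an interior node two closed cells overlap and [stepfun] adds both
    values. *)
Lemma stepfun_cell j (c : nat -> R) x : (j < ncells A)%N ->
  nth 0 (nodes A) j < x < nth 0 (nodes A) j.+1 -> stepfun A c x = c j.
Proof.
move=> jA /andP[jx xj]; rewrite /stepfun (bigD1 (Ordinal jA))//= big1.
  rewrite addr0 indicE mem_set ?mulr1// /cell /= in_itv/=.
  by rewrite (ltW jx) (ltW xj).
move=> i ij; rewrite indicE memNset ?mulr0// /cell /= in_itv/= => /andP[ix xi].
have {ij} : nat_of_ord i != j by apply: contraNneq ij => ij; exact/eqP/val_inj.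
rewrite neq_ltn => /orP[ij|ji].
  have := nodes_le ij (ltnW jA) => /(le_trans xi)/(lt_le_trans jx).
  by rewrite ltxx.
have := nodes_le ji (ltnW (ltn_ord i)) => /(lt_le_trans xj)/(fun h =>
  lt_le_trans h ix).
by rewrite ltxx.
Qed.

Lemma ae_cst_off_stepfun_ex (u : R -> R) : ae_cst_off [set` A] 0 1 u ->
  exists c : nat -> R, u = stepfun A c %[ae mu].
Proof.
move=> H; have /choice[c Hc] : forall j, exists p : R, (j < ncells A)%N ->
    u = cst p %[ae mu in `](nth 0 (nodes A) j), (nth 0 (nodes A)
      j.+1)[%classic].
  move=> j; have [jA|jA] := ltnP j (ncells A); last by exists 0.
  have [||||p Hp] := H (nth 0 (nodes A) j) (nth 0 (nodes A) j.+1).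
  - by have /andP[] := nth_nodes01 (ltnW jA).
  - exact: nodes_lt.
  - by have /andP[] := nth_nodes01 jA.
  - by move=> t tA; apply: cell_between => //; rewrite mem_nodes tA !orbT.
  by exists p.
exists c.
have Hall : \forall x \ae mu, forall j, (j < ncells A)%N ->
    nth 0 (nodes A) j < x < nth 0 (nodes A) j.+1 -> u x = c j.
  apply: ae_foralln => j; have [jA|jA] := ltnP j (ncells A); last exact: aeW.
  by apply: (ae_imp _ (Hc j jA)) => x /= + _ xj; apply; rewrite in_itv.
have Hn : \forall x \ae mu, 0 < x < 1 /\ x \notin nodes A.
  exact: (@ae01 _ (nodes A)).
apply: (ae_imp _ (ae_and Hall Hn)) => x /= [h1 [x01 xn]] _.
have [j jA xj] := locate_cell x01 xn.
by rewrite (h1 j)// (@stepfun_cell j).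
Qed.

End in_unit_interval.

Lemma integrable01_cell_sum n (c p q : nat -> R) :
  integrable01 (fun x => \sum_(j < n) c j * \1_`[p j, q j] x).
Proof. by apply: (@integrable01_sum _ n (fun j x => c j * \1_`[p j, q j] x)) =>
  j _; exact: integrable01_scale_indic. Qed.

Lemma integrable01_stepfun A (c : nat -> R) : integrable01 (stepfun A c).
Proof.
exact: (integrable01_cell_sum _ c (fun j => nth 0 (nodes A) j)
  (fun j => nth 0 (nodes A) j.+1)).
Qed.

(** Stated for general intervals rather than cells, because recovery sequences move the end points
    and some intervals may shrink to a point. *)
Lemma ae_cst_off_cell_sum T n (c p q : nat -> R) :
  (forall j, (j < n)%N -> [/\ T (p j) \/ p j \in [:: 0;
    1] & T (q j) \/ q j \in [:: 0; 1]]) ->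
  ae_cst_off T 0 1 (fun x => \sum_(j < n) c j * \1_`[p j, q j] x).
Proof.
move=> H a b a0 ab b1 nT.
(* The value at the midpoint. No end point lies in ]a, b[, so every indicator is constant there. *)
exists (\sum_(j < n) c j * \1_`[p j, q j] ((a + b) / 2)).
have nin y : T y \/ y \in [:: 0; 1] -> y <= a \/ b <= y.
  move=> yT; apply/orP; rewrite !leNgt -negb_and; apply/negP => ayb.
  case: yT => [/nT//|]; rewrite !inE => /orP[] /eqP yE; move: ayb; rewrite yE.
    by rewrite ltNge a0.
  by rewrite andbC ltNge b1.
apply: aeW => x /=; rewrite in_itv/= => /andP[ax xb].
apply: eq_bigr => j _; congr (_ * _); rewrite !indicE; congr (_%:R).
congr nat_of_bool; have [/nin hp /nin hq] := H j (ltn_ord j).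
by apply/idP/idP; rewrite !inE/= !in_itv/= => /andP[h1 h2]; apply/andP;
  split; case: hp; case: hq; lra.
Qed.

Lemma ae_cst_off_stepfun A (c : nat -> R) : ae_cst_off [set` A] 0 1 (stepfun A
  c).
Proof.
apply: (@ae_cst_off_cell_sum _ _ c (fun j => nth 0 (nodes A) j) (fun j =>
  nth 0 (nodes A) j.+1)).
move=> j jA; have h i : (i <= ncells A)%N ->
    [set` A] (nth 0 (nodes A) i) \/ nth 0 (nodes A) i \in [:: 0; 1].
  move=> /nth_nodes; rewrite mem_nodes => /or3P[h|h|h]; [right|right|by left];
    by rewrite !inE h ?orbT.
by split; apply: h => //; exact: ltnW.
Qed.

Lemma jumps01 (u : L1 R) : jumps u `<=` `[0, 1]%classic.
Proof. by move=> t [/andP[t0 t1] _]; rewrite /= in_itv/= !ltW. Qed.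

Lemma ae_cst_off_jumps_fset s (u : L1 R) : ae_cst_off [set` s] 0 1 u ->
  exists B, [/\ [set` B] = jumps u, (#|` B| <= size s)%N & ae_cst_off [set` B] 0
    1 u].
Proof.
move=> H; have us := jumps_sub H.
have fj : finite_set (jumps u) by apply: sub_finite_set us _; exact: finite_seq.
exists (fset_set (jumps u)); rewrite fset_setK//; split => //;
  last exact: ae_cst_off_jumps H.
apply: uniq_leq_size; first exact: fset_uniq.
by move=> x xj; apply: us; move: xj; rewrite in_fset_set// inE.
Qed.

Lemma PC_jumps (u : L1 R) : PC u ->
  exists B, [/\ [set` B] = jumps u, ae_cst_off [set` B] 0 1 u & exists c :
    nat -> R, (u : R -> R) = stepfun B c %[ae mu]].
Proof.
move=> [A [c [A01 uA]]].
have /ae_cst_off_jumps_fset[B [BE _ HB]] : ae_cst_off [set` enum_fset A] 0 1 u.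
  exact: ae_eq_ae_cst_off uA (ae_cst_off_stepfun (A := A) c).
exists B; split => //; apply: ae_cst_off_stepfun_ex => //; rewrite BE;
  exact: jumps01.
Qed.

Lemma ae_cst_off_PC s (u : L1 R) : ae_cst_off [set` s] 0 1 u -> PC u.
Proof.
move=> /ae_cst_off_jumps_fset[B [BE _ HB]].
have B01 : [set` B] `<=` `[0, 1]%classic by rewrite BE; exact: jumps01.
by have [c uc] := ae_cst_off_stepfun_ex B01 HB; exists B, c.
Qed.

(* J is lower semicontinuous without any compactness: [u] is non-constant on n.+1
   disjoint intervals, which is stable under small L1 perturbations. *)
Lemma J_lsc (n : nat) (u : L1 R) : (PC u -> (n.+1%:R%:E <= J u)%E) ->
  exists2 e, 0 < e & forall v : L1 R, norm1 (v \- u) < e -> PC v ->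
    (n.+1%:R%:E <= J v)%E.
Proof.
move=> H; have alt : adjacent_nonconst n.+1 0 1 u.
  apply: contrapT => /(nonconst_le_ae_cst_off (lexx 0) ler01 (lexx 1))[s sn Hs].
  have [B [BE Bs _]] := ae_cst_off_jumps_fset Hs.
  have := H (ae_cst_off_PC Hs); rewrite (J_fset BE) lee_fin ler_nat.
  by move=> /leq_trans/(_ Bs); rewrite ltnNge sn.
have [e e0 He] := adjacent_nonconst_open (L1_integrable01 u) (lexx 0) (lexx 1)
  alt.
exists e => // v vu /PC_jumps[B [BE HB _]].
rewrite (J_fset BE) lee_fin ler_nat.
exact: ae_cst_off_nonconst_le HB (He v (L1_integrable01 v) vu).
Qed.

End step_functions.

(** * Convergence of the sampled data *)

Section sampling_convergence.
Context {R : realType}.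
Local Notation mu := (mu01 R).
Implicit Types (a b d e t x : R) (A B : {fset R}) (X : nat -> {fset R}).

Lemma disc_mono X k l : discretization_sets X -> (k <= l)%N ->
  (X k `<=` X l)%fset.
Proof.
move=> hX; elim: l => [|l IH]; first by rewrite leqn0 => /eqP ->.
rewrite leq_eqVlt => /predU1P[->//|]; rewrite ltnS => /IH kl.
exact: fsubset_trans kl (disc_nested hX l).
Qed.

(** Density gives one index for each point of a finite grid of step h < e / 2, and by nestedness the
    largest index serves them all. Every t is within h of a grid point. *)
Lemma disc_uniform X e : discretization_sets X -> 0 < e ->
  exists K, forall k, (K <= k)%N -> forall t, 0 <= t <= 1 ->
    exists2 x, x \in X k & `|x - t| < e.
Proof.
move=> hX e0; have e20 : 0 < e / 2 by rewrite divr_gt0.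
have [N _ HN] : \forall n \near \oo, n.+1%:R^-1 < e / 2 :> R.
  exact: near_infty_natSinv_lt (PosNum e20).
have {HN} := HN N (leqnn N); set h : R := N.+1%:R^-1 => he.
have h0 : 0 < h by rewrite invr_gt0.
have hN : N.+1%:R * h = 1 by rewrite mulfV// pnatr_eq0.
have /choice[kk Hkk] : forall i : nat, exists k, (i <= N.+1)%N ->
    exists2 x, x \in X k & `|x - i%:R * h| < e / 2.
  move=> i; have [iN|iN] := leqP i N.+1; last by exists 0%N.
  have ti : `[0, 1]%classic (i%:R * h).
    rewrite /= in_itv/= mulr_ge0 ?ler0n ?(ltW h0)//=.
    by rewrite -[leRHS]hN ler_pM2r// ler_nat.
  have [x [[k _ /= xk] xb]] := disc_dense hX ti (nbhsx_ballx _ _ e20).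
  by exists k => _; exists x => //; rewrite distrC.
exists (\max_(i < N.+2) kk i)%N => k Kk t /andP[t0 t1].
pose i := Num.trunc (t * N.+1%:R).
have tN0 : 0 <= t * N.+1%:R by rewrite mulr_ge0.
have /andP[it ti] : i%:R <= t * N.+1%:R < i.+1%:R by exact: truncn_itv.
have iN : (i <= N.+1)%N.
  rewrite -(ler_nat R); apply: le_trans it _.
  by rewrite ler_piMl.
have [x xi xe] := Hkk i iN; exists x.
  apply: (fsubsetP (disc_mono hX _)) xi; apply: leq_trans Kk.
  by rewrite -ltnS in iN; exact: (leq_bigmax (Ordinal iN)).
have tE : t = t * N.+1%:R * h by rewrite -mulrA hN mulr1.
have it' : i%:R * h <= t by rewrite [leRHS]tE ler_pM2r.
have ti' : t < i%:R * h + h.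
  by rewrite [ltLHS]tE -[X in _ < _ + X]mul1r -mulrDl natr1 ltr_pM2r.
apply: le_lt_trans (ler_distD (i%:R * h) _ _) _.
rewrite [ltRHS]splitr ltrD// (le_lt_trans _ he)//.
by rewrite distrC ger0_norm ?subr_ge0// lerBlDl ltW.
Qed.

(** In a cell of length at least e, a point of the discretization within e / 2 of the midpoint would
    be a node in the interior of the cell. *)
Lemma disc_mesh X e : discretization_sets X -> 0 < e ->
  exists K, forall k, (K <= k)%N -> forall j, (j < ncells (X k))%N ->
    nth 0 (nodes (X k)) j.+1 - nth 0 (nodes (X k)) j < e.
Proof.
move=> hX e0; have e20 : 0 < e / 2 by rewrite divr_gt0.
have [K HK] := disc_uniform hX e20; exists K => k Kk j jX.
have /andP[p0 _] := nth_nodes01 (@disc_sub _ _ hX k) (ltnW jX).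
have /andP[_ q1] := nth_nodes01 (@disc_sub _ _ hX k) jX.
have pq := nodes_lt (ltnSn j) jX.
have nb := @cell_between _ (X k) j.
set p := nth 0 _ j in p0 pq nb *; set q := nth 0 _ j.+1 in q1 pq nb *.
have [|x xX] := HK k Kk ((p + q) / 2).
  by apply/andP; split; lra.
rewrite ltr_norml => /andP[x1 x2]; rewrite ltNge; apply/negP => eq.
apply: (nb x jX); first by rewrite mem_nodes xX !orbT.
by apply/andP; split; lra.
Qed.

(** Heine-Cantor by sequences: pairs at distance below 1 / (n + 1) whose values stay e apart would
    share a limit point l in [0, 1], contradicting continuity at l. *)
Lemma unif_continuous01 (g : R -> R) e : {within `[0, 1], continuous g} ->
  0 < e ->
  exists2 d, 0 < d & forall x y, 0 <= x <= 1 -> 0 <= y <= 1 -> `|x - y| < d ->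
    `|g x - g y| < e.
Proof.
move=> /subspace_continuousP gc e0; apply: contrapT => nd.
have /choice[z Hz] : forall n : nat, exists z : R * R,
    [/\ 0 <= z.1 <= 1, 0 <= z.2 <= 1, `|z.1 - z.2| < n.+1%:R^-1 & e <=
      `|g z.1 - g z.2|].
  move=> n; apply: contrapT => nz; apply: nd; exists n.+1%:R^-1 => //.
  move=> x y x01 y01 xy; rewrite ltNge; apply/negP => exy.
  by apply: nz; exists (x, y).
pose zx n := (z n).1.
have [phi phi_incr pl] : exists2 f : nat -> nat, increasing_seq f & cvgn (zx \o
  f).
  apply: bolzano_weierstrass; exists 1; split; first exact: num_real.
  move=> y /ltW y1 n _; have [/andP[h0 h1] _ _ _] := Hz n.
  by rewrite /= /zx ger0_norm//; exact: le_trans y1.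
set l := limn (zx \o phi) in pl.
have l01 : 0 <= l <= 1.
  apply/andP; split.
    by apply: limr_ge => //; apply: nearW => n; have [/andP[]] := Hz (phi n).
  by apply: limr_le => //; apply: nearW => n; have [/andP[]] := Hz (phi n).
have e20 : 0 < e / 2 by rewrite divr_gt0.
have : `[0, 1]%classic l by rewrite /= in_itv.
move=> /gc /cvgrPdist_lt/(_ _ e20).
rewrite near_withinE => /nbhs_ballP[d /= d0 Hd].
have d20 : 0 < d / 2 by rewrite divr_gt0.
have [N _ HN] : \forall n \near \oo, n.+1%:R^-1 < d / 2 :> R.
  exact: near_infty_natSinv_lt (PosNum d20).
have /cvgrPdist_lt/(_ _ d20)[M _ HM] := pl.
pose n := maxn N M.
have [h1 h2 h3 h4] := Hz (phi n).
have hM : `|l - (z (phi n)).1| < d / 2 by apply: HM; exact: leq_maxr.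
have hN : `|(z (phi n)).1 - (z (phi n)).2| < d / 2.
  apply: lt_trans h3 _; apply: HN => /=.
  exact: leq_trans (leq_maxl _ _) (increasing_seq_ge n phi_incr).
have k1 : `|g l - g (z (phi n)).1| < e / 2.
  apply: Hd; last by rewrite in_itv.
  by rewrite /ball/=; apply: lt_trans hM _; rewrite ltr_pdivrMr// ltr_pMr//
    ltr1n.
have k2 : `|g l - g (z (phi n)).2| < e / 2.
  apply: Hd; last by rewrite in_itv.
  rewrite /ball/= [ltRHS]splitr; apply: le_lt_trans (ler_distD (z (phi n)).1 _
    _) _.
  exact: ltrD.
move: h4; rewrite leNgt => /negP; apply.
rewrite [ltRHS]splitr; apply: le_lt_trans (ler_distD (g l) _ _) _.
by rewrite ltrD// distrC.
Qed.

Lemma norm1_cst c : norm1 (cst c : R -> R) = `|c|.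
Proof.
rewrite /norm1/= Rintegral_cst// -[RHS]mulr1; congr (_ * _).
by have /(congr1 fine) := @mu01T R.
Qed.

Lemma stepfun_near A (c : nat -> R) (f g : R -> R) e :
  [set` A] `<=` `[0, 1]%classic -> integrable01 f -> f = g %[ae mu] ->
  (forall j x, (j < ncells A)%N -> cell A j x -> `|c j - g x| <= e) ->
  norm1 (stepfun A c \- f) <= e.
Proof.
move=> A01 hf fg H.
have e0 : 0 <= e.
  have A0 := ncells_gt0 A; apply: le_trans (H 0%N (nth 0 (nodes A) 0) A0 _) =>
    //.
  by rewrite /cell/= in_itv/= lexx nodes_le.
rewrite -[leRHS]ger0_norm// -norm1_cst; apply: norm1_le.
- by apply: integrable01B => //; exact: integrable01_stepfun.
- exact: integrable01_cst.
have Hn : \forall x \ae mu, 0 < x < 1 /\ x \notin nodes A by exact: (@ae01 _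
  (nodes A)).
apply: (ae_imp _ (ae_and Hn fg)) => x /= [[x01 xn]] /(_ I) ->.
have [j jA xj] := locate_cell x01 xn.
rewrite (@stepfun_cell _ A j)// [leRHS]ger0_norm//; apply: H => //.
by move: xj => /andP[/ltW x1 /ltW x2]; rewrite /cell/= in_itv/= x1.
Qed.

Lemma Rintegral_sum n (F : nat -> R -> R) : (forall i, (i < n)%N ->
  integrable01 (F i)) ->
  \int[mu]_x (\sum_(i < n) F i x) = \sum_(i < n) \int[mu]_x F i x.
Proof.
elim: n => [|n IH] H.
  rewrite big_ord0; under eq_Rintegral do rewrite big_ord0.
  by rewrite Rintegral_cst// mul0r.
under eq_Rintegral do rewrite big_ord_recr/=.
rewrite big_ord_recr/= RintegralD//; last exact: H.
  by rewrite IH// => i /ltnW; exact: H.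
by apply: integrable01_sum => i /ltnW; exact: H.
Qed.

(* Cellwise averaging contracts the L1 norm and fixes step functions, so it is
   quasi-optimal among the step functions on the same cells. *)
Lemma integral_sampling_le (f : L1 R) A (s c : nat -> R) :
  [set` A] `<=` `[0, 1]%classic -> integral_sampling f A s ->
  norm1 (stepfun A s \- f) <= 2 * norm1 (f \- stepfun A c).
Proof.
move=> A01 fs; have hf := L1_integrable01 f; have hs :=
  integrable01_stepfun A s; have hc := integrable01_stepfun A c.
(* The triangle inequality through [stepfun A c] produces the factor 2. What remains is that
   averaging f - c over the cells contracts the norm. *)
apply: le_trans (norm1_distD hs hc hf) _; rewrite mulrDl mul1r -[X in _ + X <=
  _]norm1_distC lerD2r.
pose len j := nth 0 (nodes A) j.+1 - nth 0 (nodes A) j.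
have lenE j : (j < ncells A)%N -> norm1 (\1_(cell A j)) = len j.
  move=> jA; have /andP[p0 _] := nth_nodes01 A01 (ltnW jA).
  have /andP[_ q1] := nth_nodes01 A01 jA.
  by apply: norm1_indic => //; exact: nodes_le.
have h1 j : integrable01 (\1_(cell A j) : R -> R).
  exact: integrable01_itv.
have mcell j : measurable (cell A j) by exact: measurable_itv.
have hfc j : integrable01 (fun x => (f x - c j) * \1_(cell A j) x).
  by apply: integrable01_mul_indic => //; apply: integrable01B => //;
    exact: integrable01_cst.
have key j : (j < ncells A)%N ->
    `|s j - c j| * len j <= norm1 (fun x => (f x - c j) * \1_(cell A j) x).
  move=> jA; have /andP[p0 _] := nth_nodes01 A01 (ltnW jA).
  have /andP[_ q1] := nth_nodes01 A01 jA.
  have pq := nodes_lt (ltnSn j) jA.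
  have l0 : 0 < len j by rewrite subr_gt0.
  apply: le_trans (le_normr_Rintegral measurableT (hfc j)).
  rewrite -[len j](ger0_norm (ltW l0)) -normrM.
  suff -> : (s j - c j) * len j = \int[mu]_x ((f x - c j) * \1_(cell A j) x) by
    [].
  rewrite (fs j jA) (Rintegral_cell hf p0 q1).
  have -> : fine (lebesgue_measure (cell A j)) = len j.
    by rewrite /cell lebesgue_measure_itv/= lte_fin pq -EFinB.
  rewrite mulrBl [X in X - _]mulrC mulrA mulfV ?gt_eqF// mul1r.
  have -> : c j * len j = \int[mu]_x (c j * \1_(cell A j) x).
    rewrite RintegralZl//; last exact: h1.
    rewrite -lenE//; congr (_ * _).
    by apply: eq_Rintegral => x _; rewrite ger0_norm.
  rewrite -RintegralB//; [|exact: integrable01_mul_indic|exact: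
    integrable01_scale_indic].
  by apply: eq_Rintegral => x _; rewrite mulrBl.
have -> : stepfun A s \- stepfun A c = stepfun A (fun j => s j - c j).
  apply/funext => x; rewrite /stepfun /= -sumrB; apply: eq_bigr => j _.
  by rewrite mulrBl.
apply: (@le_trans _ _ (\sum_(j < ncells A) `|s j - c j| * len j)).
  apply: le_trans (@norm1_sum _ (ncells A) (fun j x =>
    (s j - c j) * \1_(cell A j) x) _) _.
    by move=> j _; exact: integrable01_scale_indic.
  by apply: ler_sum => j _; rewrite norm1Z// lenE.
apply: (@le_trans _ _ (\sum_(j < ncells A) norm1 (fun x =>
  (f x - c j) * \1_(cell A j) x))).
  by apply: ler_sum => j _; exact: key.
rewrite /norm1 -(@Rintegral_sum (ncells A) (fun j x =>
  `|(f x - c j) * \1_(cell A j) x|)); last first.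
  by move=> j _; exact: integrable01_norm.
have hsum : integrable01 (fun x => \sum_(j < ncells A) `|(f x - c j) * \1_(cell
  A j) x|).
  by apply: (@integrable01_sum _ (ncells A) (fun j x =>
    `|(f x - c j) * \1_(cell A j) x|)) => j _; exact: integrable01_norm.
have -> : \int[mu]_x (\sum_(j < ncells A) `|(f x - c j) * \1_(cell A j) x|) =
    norm1 (fun x => \sum_(j < ncells A) `|(f x - c j) * \1_(cell A j) x|).
  by apply: eq_Rintegral => x _; rewrite ger0_norm// sumr_ge0.
apply: norm1_le => //; first exact: integrable01B.
have Hn : \forall x \ae mu, 0 < x < 1 /\ x \notin nodes A by exact: (@ae01 _
  (nodes A)).
apply: (ae_imp _ Hn) => x /= [x01 xn]; have [j jA xj] := locate_cell x01 xn.
rewrite (@stepfun_cell _ A j)//.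
rewrite (_ : \sum_(_ < _) _ = stepfun A (fun j => `|f x - c j|) x).
  by rewrite (@stepfun_cell _ A j)// normr_id.
by apply: eq_bigr => i _; rewrite normrM [X in _ * X]ger0_norm.
Qed.

End sampling_convergence.

(** * Approximation by continuous functions and convergence of the samples *)

Section sampling_limit.
Context {R : realType}.
Local Notation mu := (mu01 R).
Local Notation leb := (@lebesgue_measure R).
Implicit Types (a b d e t x : R) (A B : {fset R}) (X : nat -> {fset R}).

Lemma ge0_integral_mu01 (h : R -> \bar R) : measurable_fun setT h ->
  (forall x, 0 <= h x)%E ->
  (\int[mu]_x h x = \int[leb]_(x in `[0%R, 1%R]) h x)%E.
Proof.
move=> mh h0; have mI : measurable (`[0, 1]%classic :
  set R) by exact: measurable_itv.
rewrite (@ge0_negligible_integral _ _ _ mu setT (~` `[0, 1]%classic))//.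
- rewrite setTD setCK; apply: eq_measure_integral => A mA A01.
  exact: mu01_sub.
- exact: measurableC.
- by rewrite /mu01/= /mrestr setICl measure0.
Qed.

Lemma integrable01P (h : R -> R) : measurable_fun setT h ->
  leb.-integrable `[0, 1]%classic (EFin \o h) <-> integrable01 h.
Proof.
move=> mh; have mE : measurable_fun setT (EFin \o h) by exact/measurable_EFinP.
have IE : (\int[mu]_x `|(EFin \o h) x| = \int[leb]_(x in `[0%R, 1%R]) `|(EFin \o
  h) x|)%E.
  by apply: ge0_integral_mu01 => //; exact: measurableT_comp.
split => /integrableP[_ hoo]; apply/integrableP; split.
- by [].
- by rewrite IE.
- exact: measurable_funTS.
- by rewrite -IE.
Qed.

Lemma continuous_dense (f : L1 R) e : 0 < e ->
  exists g : R -> R, [/\ continuous g, integrable01 g & norm1 (f \- g) < e].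
Proof.
move=> e0; have hf := L1_integrable01 f; have mf := integrable01_measurable hf.
have mI : measurable (`[0, 1]%classic : set R) by exact: measurable_itv.
have fI : (leb (`[0%R, 1%R]%classic : set R) < +oo)%E.
  by rewrite lebesgue_measure_itv/= lte_fin ltr01 -EFinB ltry.
have [_ /(_ hf) intf] := integrable01P mf.
have [g_ [cg ig lim0]] := approximation_continuous_integrable mI fI intf.
have mg n : measurable_fun setT (g_ n).
  by apply: continuous_measurable_fun; exact: cg.
have hg n : integrable01 (g_ n) by apply/integrable01P.
have norm1E n : (\int[leb]_(z in `[0%R, 1%R]) `|(f z - g_ n z)%:E| =
  (norm1 (f \- g_ n))%:E)%E.
  rewrite -norm1E; last exact: integrable01B.
  rewrite ge0_integral_mu01//; apply: measurableT_comp => //.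
  by apply/measurable_EFinP; exact: measurable_funB.
have : (norm1 (f \- g_ n))%:E @[n --> \oo] --> 0%E.
  by move: lim0; under eq_fun do rewrite norm1E.
move=> /fine_cvgP[_] /cvgrPdist_lt/(_ _ e0)[N _ /(_ N (leqnn N))] /=.
by rewrite sub0r normrN ger0_norm ?norm1_ge0// => gN; exists (g_ N).
Qed.

Lemma sampling_limit (f : L1 R) X S e : discretization_sets X ->
  sampling f X S ->
  0 < e -> exists K, forall k, (K <= k)%N -> norm1 (stepfun (X k) (S k) \- f) <
    e.
Proof.
move=> hX hS e0; have near_le (g : R -> R) (e' : R) :
  {within `[0, 1], continuous g} -> 0 < e' ->
    exists K, forall k, (K <= k)%N -> forall j x y, (j < ncells (X k))%N ->
      cell (X k) j x -> cell (X k) j y -> `|g x - g y| <= e'.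
  move=> gc e'0; have [d d0 Hd] := unif_continuous01 gc e'0.
  have [K HK] := disc_mesh hX d0; exists K => k Kk j x y jX.
  have /andP[p0 _] := nth_nodes01 (@disc_sub _ _ hX k) (ltnW jX).
  have /andP[_ q1] := nth_nodes01 (@disc_sub _ _ hX k) jX.
  have := HK k Kk j jX.
  rewrite /cell/= !in_itv/=; set p := nth 0 _ j in p0 *;
    set q := nth 0 _ j.+1 in q1 *.
  move=> pq /andP[x1 x2] /andP[y1 y2]; apply/ltW/Hd.
  - by rewrite (le_trans p0 x1) (le_trans x2 q1).
  - by rewrite (le_trans p0 y1) (le_trans y2 q1).
  - by rewrite ltr_norml; apply/andP; split; lra.
case: hS => [hS|[g [gc fg hS]]].
  (* Quasi-optimality doubles the sum of |f - g| and |g - c|, each of norm at most e / 8, which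
     leaves e / 2 < e. *)
  have e80 : 0 < e / 8 by rewrite divr_gt0.
  have [g [cg hg fg]] := continuous_dense f e80.
  have gc : {within `[0, 1], continuous g} by exact: continuous_subspaceT.
  have [K HK] := near_le g _ gc e80.
  exists K => k Kk; have A01 := @disc_sub _ _ hX k.
  (* The competitor takes the value of g at the left end of each cell. *)
  pose c j := g (nth 0 (nodes (X k)) j).
  have hc := integrable01_stepfun (X k) c.
  have := integral_sampling_le c A01 (hS k).
  have := norm1_distD (L1_integrable01 f) hg hc.
  have : norm1 (stepfun (X k) c \- g) <= e / 8.
    apply: (stepfun_near (g := g)) => //; first exact: aeW.
    move=> j x jA xj; apply: (HK k Kk j) => //.
    by rewrite /cell/= in_itv/= lexx nodes_le.
  by rewrite norm1_distC; lra.
have e20 : 0 < e / 2 by rewrite divr_gt0.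
have [K HK] := near_le g _ gc e20.
exists K => k Kk; have A01 := @disc_sub _ _ hX k.
apply: (@le_lt_trans _ _ (e / 2)); last by rewrite ltr_pdivrMr// ltr_pMr//
  ltr1n.
apply: (stepfun_near (g := g)) => //; first exact: L1_integrable01.
move=> j x jA xj; have [y yj ->] := hS k j jA.
exact: (HK k Kk j).
Qed.

End sampling_limit.

(** * Recovery sequences *)

Section recovery.
Context {R : realType}.
Local Notation mu := (mu01 R).
Implicit Types (a b d e t x y z p q : R) (A B : {fset R}) (X : nat -> {fset R}).

(** A point where the two indicators differ lies between p and x or between q and y. *)
Lemma norm1_itv_dist p q x y : 0 <= p <= 1 -> 0 <= q <= 1 -> 0 <= x <= 1 ->
  0 <= y <= 1 ->
  norm1 (\1_`[p, q] \- \1_`[x, y]) <= `|p - x| + `|q - y|.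
Proof.
have nmm a b : 0 <= a <= 1 -> 0 <= b <= 1 ->
    norm1 (\1_`[Num.min a b, Num.max a b]) = `|a - b|.
  move=> /andP[a0 a1] /andP[b0 b1]; have [ab|/ltW ba] := leP a b.
    by rewrite norm1_indic// ler0_norm ?subr_le0// opprB.
  by rewrite norm1_indic// ger0_norm ?subr_ge0.
have hi a b : integrable01 (\1_`[a, b] : R -> R) by exact: integrable01_itv.
move=> hp hq hx hy; rewrite -(nmm p x)// -(nmm q y)//.
apply: norm1_le_add => //; first exact: integrable01B.
apply: aeW => z /=; rewrite [X in _ <= X + _]ger0_norm// [X in _ <=
  _ + X]ger0_norm//.
rewrite !indicE !mem_setE !in_itv/= !ge_min !le_max.
by have [pz|pz] := leP p z; have [qz|qz] := leP z q; have [xz|xz] := leP x z;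
  have [yz|yz] := leP z y; rewrite /= ?(ltW pz) ?(ltW qz) ?(ltW xz) ?(ltW yz)
    ?orbT ?andbT/=
   ?subrr ?normr0 ?subr0 ?sub0r ?normrN ?normr1 ?addr_ge0 ?ler0n ?lerDl ?lerDr
     ?ler0n.
Qed.

Lemma L1cvgP (u_ : nat -> L1 R) (u : L1 R) :
  L1cvg u_ u <-> norm1 (u_ n \- u) @[n --> \oo] --> 0.
Proof.
rewrite /L1cvg (_ : (fun k => L1dist (u_ k) u) = fun n =>
  (norm1 (u_ n \- u))%:E); last first.
  by apply/funext => n; rewrite L1distE//; exact: L1_integrable01.
split=> [/fine_cvgP[_ h]|h]; first exact: h.
by apply/fine_cvgP; split; [exact: nearW|exact: h].
Qed.

Lemma seq_argmin (s : seq R) y t : exists2 z, z \in y :: s &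
  forall x, x \in y :: s -> `|z - t| <= `|x - t|.
Proof.
elim: s => [|x s [z zs Hz]].
  by exists y; rewrite ?mem_head// => x; rewrite inE => /eqP ->.
have [zx|/ltW xz] := leP `|z - t| `|x - t|.
  exists z; first by move: zs; rewrite !inE => /orP[->//|->]; rewrite !orbT.
  move=> w; rewrite !inE => /or3P[/eqP->|/eqP->//|ws]; apply: Hz;
    rewrite ?mem_head//.
  by rewrite inE ws orbT.
exists x; first by rewrite !inE eqxx orbT.
move=> w; rewrite !inE => /or3P[/eqP->|/eqP->//|ws]; apply: (le_trans xz);
  apply: Hz.
  by rewrite mem_head.
by rewrite inE ws orbT.
Qed.

(** Adding 0 to the candidates guarantees a nearest point even if [X k] is empty. It does no harm,
    as a jump lies in ]0, 1[. *)
Lemma disc_approx X : discretization_sets X -> exists pi : nat -> R -> R,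
  (forall k t, pi k t \in 0 :: enum_fset (X k)) /\
  (forall e, 0 < e -> exists K, forall k, (K <= k)%N ->
     forall t, 0 <= t <= 1 -> `|pi k t - t| < e).
Proof.
move=> hX.
have /choice[pi Hpi] : forall kt : nat * R, exists z, z \in 0 :: enum_fset (X
  kt.1) /\
    forall x, x \in 0 :: enum_fset (X kt.1) -> `|z - kt.2| <= `|x - kt.2|.
  by move=> [k t]; have [z zX Hz] := seq_argmin (enum_fset (X k)) 0 t; exists z.
exists (fun k t => pi (k, t)); split => [k t|e e0]; first exact: (Hpi (k, t)).1.
have [K HK] := disc_uniform hX e0; exists K => k Kk t t01.
have [x xX] := HK k Kk t t01; apply: le_lt_trans.
by apply: (Hpi (k, t)).2; rewrite inE/= xX orbT.
Qed.

Lemma norm1_cell_sum_dist n (c : nat -> R) (p q x y : nat -> R) e :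
  (forall j, (j < n)%N -> [/\ 0 <= p j <= 1, 0 <= q j <= 1, 0 <= x j <= 1 & 0 <=
    y j <= 1]) ->
  (forall j, (j < n)%N -> `|p j - x j| <= e /\ `|q j - y j| <= e) ->
  norm1 ((fun z => \sum_(j < n) c j * \1_`[p j, q j] z) \-
      (fun z => \sum_(j < n) c j * \1_`[x j, y j] z)) <=
        (\sum_(j < n) `|c j|) * (e + e).
Proof.
move=> H He; set F := (X in norm1 X).
have -> : F = fun z => \sum_(j < n) (c j * (\1_`[p j, q j] z - \1_`[x j, y j]
  z)).
  by apply/funext => z; rewrite /F/= -sumrB; apply: eq_bigr => j _;
    rewrite mulrBr.
have hi a b : integrable01 (\1_`[a, b] : R -> R) by exact: integrable01_itv.
apply: le_trans (@norm1_sum _ n (fun j z => c j * (\1_`[p j, q j] z - \1_`[x j,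
  y j] z)) _) _.
  by move=> j _; apply: integrable01Z; exact: integrable01B.
rewrite mulr_suml; apply: ler_sum => j _; rewrite (@norm1Z _ (c j) (\1_`[p j, q
  j] \- \1_`[x j, y j])); last exact: integrable01B.
have [? ? ? ?] := H j (ltn_ord j); have [h1 h2] := He j (ltn_ord j).
apply: ler_wpM2l => //; apply: le_trans (norm1_itv_dist _ _ _ _) _ => //.
exact: lerD.
Qed.

Lemma recovery X (u : L1 R) : discretization_sets X -> PC u ->
  exists u_ : nat -> L1 R, L1cvg u_ u /\
    forall k, PCk (X k) (u_ k) /\ (J (u_ k) <= J u)%E.
Proof.
move=> hX uPC; have [B [BE _ [c uc]]] := PC_jumps uPC.
have B01 : [set` B] `<=` `[0, 1]%classic by rewrite BE; exact: jumps01.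
have [pi [piX Hpi]] := disc_approx hX.
(* The ends of [0, 1] stay fixed, so the moved intervals still reach from 0 to 1. *)
pose P k x := if x \in [:: 0; 1] then x else pi k x.
have P01 k x : 0 <= x <= 1 -> 0 <= P k x <= 1.
  move=> x01; rewrite /P; case: ifP => // _.
  have := piX k x; rewrite inE => /predU1P[->|]; first by rewrite lexx ler01.
  by move=> /(@disc_sub _ _ hX k); rewrite /= in_itv.
pose nd j := nth 0 (nodes B) j.
pose v k z := \sum_(j < ncells B) c j * \1_`[P k (nd j), P k (nd j.+1)] z.
have hv k : integrable01 (v k) by exact: (integrable01_cell_sum _ c (fun j =>
  P k (nd j)) (fun j => P k (nd j.+1))).
have /choice[u_ Hu] : forall k, exists w : L1 R, (w : R -> R) = v k %[ae mu].
  by move=> k; exact: L1_exists.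
have nd01 j : (j <= ncells B)%N -> 0 <= nd j <= 1 by exact: nth_nodes01.
exists u_; split.
  apply/L1cvgP/cvgrPdist_lt => e e0.
  pose C := \sum_(j < ncells B) `|c j|.
  have C0 : 0 <= C by exact: sumr_ge0.
  (* Each moved interval has two end points, hence the 2; the 1 covers the case where all c_j
     vanish. *)
  have C10 : 0 < (C + 1) * 2 by rewrite mulr_gt0// ltr_wpDl.
  have e'0 : 0 < e / ((C + 1) * 2) by rewrite divr_gt0.
  have [K HK] := Hpi _ e'0.
  exists K => // k /= Kk; rewrite sub0r normrN ger0_norm ?norm1_ge0//.
  have -> : norm1 (u_ k \- u) = norm1 (v k \- stepfun B c).
    apply: ae_eq_norm1.
    - by apply: integrable01B; exact: L1_integrable01.
    - by apply: integrable01B => //; exact: integrable01_stepfun.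
    - by apply: (ae_imp _ (ae_and (Hu k) uc)) => x /= [/(_ I)-> /(_ I) ->].
  have d0 x : 0 <= x <= 1 -> `|P k x - x| <= e / ((C + 1) * 2).
    move=> x01; rewrite /P; case: ifP => _; first by rewrite subrr normr0 ltW.
    by apply/ltW/HK.
  apply: le_lt_trans (@norm1_cell_sum_dist (ncells B) c (fun j => P k (nd j))
     (fun j => P k (nd j.+1)) nd (fun j => nd j.+1) (e / ((C + 1) * 2)) _ _) _.
  - by move=> j jB; split; rewrite ?P01 ?nd01// ltnW.
  - by move=> j jB; split; apply: d0; apply: nd01 => //; exact: ltnW.
  rewrite -/C -[ltRHS](_ : (C + 1) * (e / ((C + 1) * 2) + e / ((C +
    1) * 2)) = e).
    by rewrite ltr_pM2r ?addr_gt0// ltrDl.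
  by field; rewrite gt_eqF// ltr_wpDl.
move=> k; have uP : ae_cst_off [set` [seq pi k x | x <- enum_fset B]] 0 1 (u_
  k).
  apply: ae_eq_ae_cst_off (Hu k) _.
  apply: (@ae_cst_off_cell_sum _ _ _ c (fun j => P k (nd j)) (fun j =>
    P k (nd j.+1))).
  have h j : (j <= ncells B)%N -> [set` [seq pi k x | x <- enum_fset B]] (P k
    (nd j)) \/
      P k (nd j) \in [:: 0; 1].
    move=> /nth_nodes jB; rewrite /P; case: ifPn => h; [by right|left].
    apply: map_f; move: jB; rewrite mem_nodes -/(nd j) => /or3P[h'|h'|//];
      by rewrite !inE h' ?orbT in h.
  by move=> j jB; split; apply: h => //; exact: ltnW.
split; last first.
  have [B' [B'E sB' _]] := ae_cst_off_jumps_fset uP.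
  by rewrite (J_fset BE) (J_fset B'E) lee_fin ler_nat (leq_trans sB')//
    size_map.
split; first exact: ae_cst_off_PC uP.
move=> t jt; have /mapP[x xB tE] := jumps_sub uP jt.
have := piX k x; rewrite -tE inE => /predU1P[t0|//].
by move: jt => [/andP[]]; rewrite t0 ltxx.
Qed.

End recovery.

(** * Compactness of sums of boundedly many steps *)

Section compactness.
Context {R : realType}.
Local Notation mu := (mu01 R).
Implicit Types (a b d e x y z p q : R) (A B : {fset R}) (X : nat -> {fset R}).

Lemma cvg_subseq {T : topologicalType} (a : nat -> T) (l : T) (phi : nat ->
  nat) :
  increasing_seq phi -> a @ \oo --> l -> (a \o phi) @ \oo --> l.
Proof.
move=> incr al; apply: cvg_comp al; move=> U [N _ HN]; exists N => // n /= Nn.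
by apply: HN => /=; exact: leq_trans Nn (increasing_seq_ge n incr).
Qed.

Lemma increasing_seq_comp (phi psi : nat -> nat) :
  increasing_seq phi -> increasing_seq psi -> increasing_seq (phi \o psi).
Proof. by move=> h1 h2 m n /=; rewrite h1; exact: h2. Qed.

(** Split f into f - g, small in norm, and a continuous g, bounded by G on [0, 1] and so small in
    norm on short intervals. *)
Lemma integral_abs_continuous (f : L1 R) e : 0 < e -> exists2 d, 0 < d &
  forall a b, 0 <= a -> a <= b -> b <= 1 -> b - a < d ->
    norm1 (fun x => f x * \1_`[a, b] x) < e.
Proof.
move=> e0; have e20 : 0 < e / 2 by rewrite divr_gt0.
have [g [gc hg fg]] := continuous_dense f e20.
have gn : {within `[0%R, 1%R], continuous (fun x => `|g x|)}.
  apply: continuous_subspaceT => x; apply: continuous_comp; first exact: gc.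
  exact: norm_continuous.
have [z z01 Hz] := EVT_max ler01 gn.
set G := `|g z| in Hz; have G0 : 0 <= G by exact: normr_ge0.
have G10 : 0 < G + 1 by rewrite ltr_wpDl.
exists (e / 2 / (G + 1)); first by rewrite divr_gt0.
move=> a b a0 ab b1; rewrite ltr_pdivlMr// => bad.
have mI : measurable (`[a, b]%classic : set R) by exact: measurable_itv.
apply: (@le_lt_trans _ _ (norm1 (f \- g) + norm1 (fun x =>
  (G + 1) * \1_`[a, b] x))).
  apply: norm1_le_add.
  - by apply: integrable01_mul_indic => //; exact: L1_integrable01.
  - by apply: integrable01B => //; exact: L1_integrable01.
  - exact: integrable01_scale_indic.
  apply: (@ae01 _ [::]) => x /andP[/ltW x0 /ltW x1] _ /=.
  have gx : `|g x| <= G by apply: Hz; rewrite in_itv/= x0.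
  rewrite !normrM indicE; case: (x \in _); rewrite ?normr1 ?normr0 ?mulr1
    ?mulr0//.
  rewrite (ger0_norm (ltW G10)); have := ler_distD (g x) (f x) 0.
  by rewrite !subr0; lra.
rewrite norm1Z; last exact: integrable01_itv.
rewrite norm1_indic// (ger0_norm (ltW G10)); move: fg bad; rewrite mulrC; lra.
Qed.

(* A step that shrinks to a point is controlled by the data; on a step that does
   not, the values are bounded. *)
Lemma term_compact (f : L1 R) (f_ : nat -> R -> R) (s t c : nat -> R) M :
  (forall n, integrable01 (f_ n)) -> norm1 (f_ n \- f) @[n --> \oo] --> 0 ->
  (forall n, norm1 (f_ n) <= M) ->
  (forall n, [/\ 0 <= s n, s n <= t n & t n <= 1]) ->
  (forall n, `|c n| * (t n - s n) <= 2 * norm1 (fun x =>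
    f_ n x * \1_`[s n, t n] x)) ->
  exists phi, increasing_seq phi /\ exists2 h : R -> R, integrable01 h &
    norm1 ((fun x => c (phi n) * \1_`[s (phi n), t (phi n)] x) \- h) @[n -->
      \oo] --> 0.
Proof.
move=> hf f0 fM st ct.
have mI a b : measurable (`[a, b]%classic : set R) by exact: measurable_itv.
have bw (w : nat -> R) C : (forall n, `|w n| <= C) ->
    exists2 phi : nat -> nat, increasing_seq phi & cvgn (w \o phi).
  move=> wC; apply: bolzano_weierstrass; exists C; split; first exact: num_real.
  by move=> y /ltW Cy n _; apply: le_trans Cy; exact: wC.
have [phi1 phi1_incr s1] : exists2 phi : nat -> nat, increasing_seq phi & cvgn
  (s \o phi).
  apply: (bw _ 1) => n; have [h1 h2 h3] := st n.
  by rewrite ger0_norm// (le_trans h2).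
have [phi2 phi2_incr t1] : exists2 phi : nat -> nat, increasing_seq phi &
    cvgn ((t \o phi1) \o phi).
  apply: (bw _ 1) => n /=; have [h1 h2 h3] := st (phi1 n).
  by rewrite ger0_norm// (le_trans h1).
pose phi := phi1 \o phi2.
have phi_incr : increasing_seq phi by exact: increasing_seq_comp.
have {}s1 : cvgn (s \o phi).
  by apply/cvg_ex; exists (limn (s \o phi1)); exact: (cvg_subseq phi2_incr s1).
have {}t1 : cvgn (t \o phi) by [].
set s0 := limn (s \o phi) in s1; set t0 := limn (t \o phi) in t1.
have s00 : 0 <= s0 by apply: limr_ge => //; apply: nearW => n;
  have [] := st (phi n).
have t01 : t0 <= 1 by apply: limr_le => //; apply: nearW => n;
  have [] := st (phi n).
have st0 : s0 <= t0 by apply: ler_lim => //; apply: nearW => n;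
  have [] := st (phi n).
move: (st0); rewrite le_eqVlt => /predU1P[s0t0|s0t0].
  exists phi; split => //; exists (cst 0); first exact: integrable01_cst.
  (* The bound is twice the sum of the norm of f_n - f and the norm of f on the shrinking interval,
     hence quarters. *)
  apply/cvgrPdist_lt => e e0; have e40 : 0 < e / 4 by rewrite divr_gt0.
  have [d d0 Hd] := integral_abs_continuous f e40;
    have d20 : 0 < d / 2 by rewrite divr_gt0.
  have /cvgrPdist_lt/(_ _ d20) s2 := s1.
  have /cvgrPdist_lt/(_ _ d20) t2 := t1.
  have /cvgrPdist_lt/(_ _ e40) f2 := cvg_subseq phi_incr f0.
  near=> n; rewrite sub0r normrN ger0_norm ?norm1_ge0//.
  have [h1 h2 h3] := st (phi n).
  have -> : norm1 ((fun x => c (phi n) * \1_`[s (phi n), t (phi n)] x) \- cst 0)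
    =
      `|c (phi n)| * (t (phi n) - s (phi n)).
    rewrite -norm1_indic// -norm1Z; first by congr norm1; apply/funext => x /=;
      rewrite subr0.
    exact: integrable01_itv.
  apply: le_lt_trans (ct _) _.
  have fd : norm1 (fun x => f x * \1_`[s (phi n), t (phi n)] x) < e / 4.
    apply: Hd => //.
    have : `|s0 - s (phi n)| < d / 2 by near: n.
    have : `|t0 - t (phi n)| < d / 2 by near: n.
    by rewrite s0t0 !ltr_norml => /andP[? ?] /andP[? ?]; lra.
  have ff : norm1 (f_ (phi n) \- f) < e / 4.
    have : `|0 - norm1 (f_ (phi n) \- f)| < e / 4 by near: n.
    by rewrite sub0r normrN ger0_norm ?norm1_ge0.
  have : norm1 (fun x => f_ (phi n) x * \1_`[s (phi n), t (phi n)] x) <=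
      norm1 (f_ (phi n) \- f) + norm1 (fun x => f x * \1_`[s (phi n), t (phi n)]
        x).
    apply: norm1_le_add.
    - exact: integrable01_mul_indic.
    - by apply: integrable01B => //; exact: L1_integrable01.
    - by apply: integrable01_mul_indic => //; exact: L1_integrable01.
    apply: aeW => x /=; rewrite !normrM indicE; case: (x \in _).
      rewrite normr1 !mulr1; have := ler_distD (f x) (f_ (phi n) x) 0.
      by rewrite !subr0.
    by rewrite normr0 !mulr0 addr0.
  lra.
pose l := (t0 - s0) / 2; have l0 : 0 < l by rewrite divr_gt0// subr_gt0.
(* The bound 2 M / l on the values holds only where the interval has length at least l. Other
   indices get the value 0, which keeps the sequence bounded; they are finitely many, because the
   limit length is 2 l. *)
pose c' n := if l <= t (phi n) - s (phi n) then c (phi n) else 0.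
have M0 : 0 <= M by exact: le_trans (norm1_ge0 _) (fM 0%N).
have [psi psi_incr c1] : exists2 psi : nat -> nat, increasing_seq psi & cvgn (c'
  \o psi).
  apply: (bw _ (2 * M / l)) => n; rewrite /c'; case: ifPn => [ln|_]; last first.
    by rewrite normr0; apply: divr_ge0; [exact: mulr_ge0|exact: ltW].
  rewrite ler_pdivlMr//; apply: (@le_trans _ _ (`|c (phi n)| * (t (phi n) - s
    (phi n)))).
    by rewrite ler_wpM2l.
  apply: le_trans (ct _) _; rewrite ler_pM2l//; apply: le_trans (fM (phi n)).
  apply: norm1_le => //; first exact: integrable01_mul_indic.
  apply: aeW => x; rewrite normrM indicE; case: (x \in _).
    by rewrite normr1 mulr1.
  by rewrite normr0 mulr0.
set c0 := limn (c' \o psi) in c1.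
have theta_incr : increasing_seq (phi \o psi) by exact: increasing_seq_comp.
exists (phi \o psi); split => //.
exists (fun x => c0 * \1_`[s0, t0] x); first exact: integrable01_scale_indic.
have s2 := cvg_subseq psi_incr s1; have t2 := cvg_subseq psi_incr t1.
apply/cvgrPdist_lt => e e0; have e20 : 0 < e / 2 by rewrite divr_gt0.
have c10 : 0 < `|c0| + 1 by rewrite ltr_wpDl.
(* The error splits into the change of the value on the current interval, below e / 2, and c0 times
   the displacement of two end points. *)
have e'0 : 0 < e / 2 / (`|c0| + 1) / 2 by rewrite !divr_gt0.
have l20 : 0 < l / 2 by rewrite divr_gt0.
have /cvgrPdist_lt/(_ _ e'0) s3 := s2; have /cvgrPdist_lt/(_ _ e'0) t3 := t2.
have /cvgrPdist_lt/(_ _ l20) s4 := s2; have /cvgrPdist_lt/(_ _ l20) t4 := t2.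
have /cvgrPdist_lt/(_ _ e20) c3 := c1.
near=> n; rewrite sub0r normrN ger0_norm ?norm1_ge0//=.
have hs : `|s0 - s (phi (psi n))| < e / 2 / (`|c0| + 1) / 2 by near: n.
have ht : `|t0 - t (phi (psi n))| < e / 2 / (`|c0| + 1) / 2 by near: n.
have hsl : `|s0 - s (phi (psi n))| < l / 2 by near: n.
have htl : `|t0 - t (phi (psi n))| < l / 2 by near: n.
have hc : `|c0 - c' (psi n)| < e / 2 by near: n.
have cE : c' (psi n) = c (phi (psi n)).
  rewrite /c' ifT//; move: hsl htl.
  rewrite !ltr_norml => /andP[? ?] /andP[? ?].
  have lE : t0 - s0 = 2 * l by rewrite /l; field.
  lra.
rewrite {}cE in hc.
set k := phi (psi n) in hs ht hc *.
rewrite distrC in hs; rewrite distrC in ht; rewrite distrC in hc.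
have [h1 h2 h3] := st k.
have hi a b : integrable01 (\1_`[a, b] : R -> R) by exact: integrable01_itv.
apply: (@le_lt_trans _ _ (norm1 (fun x => (c k - c0) * \1_`[s k, t k] x) +
   norm1 (fun x => c0 * (\1_`[s k, t k] x - \1_`[s0, t0] x)))).
  apply: norm1_le_add.
  - by apply: integrable01B; exact: integrable01_scale_indic.
  - exact: integrable01_scale_indic.
  - by apply: integrable01Z; exact: integrable01B.
  apply: aeW => x /=.
  rewrite (_ : _ - _ = (c k - c0) * \1_`[s k, t k] x +
    c0 * (\1_`[s k, t k] x - \1_`[s0, t0] x)).
    exact: ler_normD.
  by ring.
rewrite [ltRHS]splitr ler_ltD//.
  rewrite norm1Z// norm1_indic//; apply: le_trans (ltW hc).
  rewrite ler_piMr//; lra.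
rewrite (@norm1Z _ c0 (\1_`[s k, t k] \- \1_`[s0, t0]));
  last exact: integrable01B.
apply: (@le_lt_trans _ _ (`|c0| * (`|s k - s0| + `|t k - t0|))).
  apply: ler_wpM2l => //; apply: norm1_itv_dist.
  - by rewrite h1 (le_trans h2).
  - by rewrite h3 (le_trans h1).
  - by rewrite s00 (le_trans st0).
  - by rewrite t01 (le_trans s00).
have [->|cn0] := eqVneq `|c0| 0; first by rewrite mul0r.
have cp : 0 < `|c0| by rewrite lt_neqAle eq_sym cn0 normr_ge0.
set D := e / 2 / (`|c0| + 1) in hs ht.
have DE : (`|c0| + 1) * D = e / 2 by rewrite /D mulrC divfK// gt_eqF.
rewrite -DE; apply: (@lt_trans _ _ (`|c0| * D)).
  by rewrite ltr_pM2l// [ltRHS]splitr ltrD.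
by rewrite ltr_pM2r ?ltrDl// /D divr_gt0.
Unshelve. all: by end_near.
Qed.

(** Induction on the number of terms: each new term is handled along a further subsequence, which
    preserves the earlier limits. *)
Lemma terms_compact m (f : L1 R) (f_ : nat -> R -> R) (s t c : nat -> nat ->
  R) M :
  (forall n, integrable01 (f_ n)) -> norm1 (f_ n \- f) @[n --> \oo] --> 0 ->
  (forall n, norm1 (f_ n) <= M) ->
  (forall n j, [/\ 0 <= s n j, s n j <= t n j & t n j <= 1]) ->
  (forall n j, `|c n j| * (t n j - s n j) <= 2 * norm1 (fun x =>
    f_ n x * \1_`[s n j, t n j] x)) ->
  exists phi, increasing_seq phi /\ exists2 h : R -> R, integrable01 h &
    norm1 ((fun x => \sum_(j < m) c (phi n) j * \1_`[s (phi n) j, t (phi n) j]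
      x) \- h)
      @[n --> \oo] --> 0.
Proof.
move=> hf f0 fM st ct; elim: m => [|m [phi [phi_incr [h hh IH]]]].
  exists id; split => //; exists (cst 0); first exact: integrable01_cst.
  rewrite (_ : (fun n => norm1 _) = cst 0); first exact: cvg_cst.
  apply/funext => n; rewrite -[RHS]norm1_0; congr norm1.
  by apply/funext => x /=; rewrite big_ord0 subr0.
have [psi [psi_incr [h' hh' IH']]] := @term_compact f (f_ \o phi) (fun n =>
  s (phi n) m)
  (fun n => t (phi n) m) (fun n => c (phi n) m) M
  (fun n => hf (phi n)) (cvg_subseq phi_incr f0) (fun n => fM (phi n))
  (fun n => st (phi n) m) (fun n => ct (phi n) m).
exists (phi \o psi); split; first exact: increasing_seq_comp.
exists (h \+ h'); first exact: integrable01D.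
have lim0 := cvgD (cvg_subseq psi_incr IH) IH'; rewrite addr0 in lim0.
apply: squeeze_cvgr; [|exact: (cvg_cst 0)|exact: lim0]; apply: nearW => n;
  rewrite norm1_ge0/=.
have hS k : integrable01 (fun x => \sum_(j < m) c k j * \1_`[s k j, t k j] x).
  exact: (integrable01_cell_sum m (c k) (s k) (t k)).
apply: norm1_le_add.
- apply: integrable01B; last exact: integrable01D.
  exact: (integrable01_cell_sum m.+1 (c (phi (psi n))) (s (phi (psi n))) (t (phi
    (psi n)))).
- exact: integrable01B.
- by apply: integrable01B => //; exact: integrable01_scale_indic.
apply: aeW => x /=; rewrite big_ord_recr/= opprD addrACA.
exact: ler_normD.
Qed.

End compactness.

(** * Lower and upper limits *)

Section limits_of_extended_reals.
Context {R : realType}.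
Implicit Types (F : nat -> \bar R) (a : \bar R).

Lemma limn_einf_ge F a : (\forall k \near \oo, a <= F k)%E ->
  (a <= limn_einf F)%E.
Proof.
move=> [K _ HK]; rewrite limn_einf_lim; apply: lime_ge;
  first exact: is_cvg_einfs.
exists K => // n /= Kn; apply: le_ereal_inf_tmp => _ [k /= nk <-].
by apply: HK => /=; exact: leq_trans nk.
Qed.

Lemma limn_esup_le F a : (\forall k \near \oo, F k <= a)%E ->
  (limn_esup F <= a)%E.
Proof.
move=> [K _ HK]; rewrite limn_esup_lim; apply: lime_le;
  first exact: is_cvg_esups.
exists K => // n /= Kn; apply: ge_ereal_sup => _ [k /= nk <-].
by apply: HK => /=; exact: leq_trans nk.
Qed.

Lemma le_limn_einf F G : (forall k, F k <= G k)%E ->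
  (limn_einf F <= limn_einf G)%E.
Proof.
move=> FG; rewrite !limn_einf_lim; apply: lee_lim; [exact: is_cvg_einfs..|].
apply: nearW => n; apply: le_ereal_inf_tmp => _ [k /= nk <-].
by apply: (le_trans _ (FG k)); apply: ereal_inf_lbound; exists k.
Qed.

End limits_of_extended_reals.

(** * The Potts functionals *)

Section potts.
Context {R : realType}.
Local Notation mu := (mu01 R).
Variables (f : L1 R) (gamma : R).
Hypothesis gamma0 : 0 < gamma.

Lemma PC_J (u : L1 R) : PC u -> exists n : nat, J u = n%:R%:E.
Proof. by move=> /PC_jumps[B [BE _ _]]; exists #|` B|; exact: J_fset. Qed.

Lemma J_ge0 (u : L1 R) : (0 <= J u)%E.
Proof. exact: measure_ge0. Qed.

Lemma dPottsE A s u : PCk A u ->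
  dPotts gamma A s u = (gamma%:E * J u + (norm1 (u \- stepfun A s))%:E)%E.
Proof.
move=> uA; rewrite /dPotts asboolT// L1distE//; first exact: L1_integrable01.
exact: integrable01_stepfun.
Qed.

Lemma PottsE u : PC u -> Potts gamma f u = (gamma%:E * J u +
  (norm1 (u \- f))%:E)%E.
Proof. by move=> uA; rewrite /Potts asboolT// L1distE//;
  exact: L1_integrable01. Qed.

(** * Gamma-convergence and compactness for one sequence of discretizations *)

Section discretized.
Variables (X : nat -> {fset R}) (S : nat -> nat -> R).
Hypotheses (hX : discretization_sets X) (hS : sampling f X S).

Let F k := dPotts gamma (X k) (S k).
Let g k := stepfun (X k) (S k).

Let hg k : integrable01 (g k). Proof. exact: integrable01_stepfun. Qed.

Lemma data_cvg : norm1 (g k \- f) @[k --> \oo] --> 0.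
Proof.
apply/cvgrPdist_lt => e e0; have [K HK] := sampling_limit hX hS e0.
by exists K => // k /= /HK; rewrite sub0r normrN ger0_norm ?norm1_ge0.
Qed.

(** The bound n <= J u is assumed under [PC u] only, so outside [PC] it may be used with n as large
    as desired. The two halves of e pay for replacing u_k by u and the sampled data by f. *)
Lemma dPotts_eventually_ge (u_ : nat -> L1 R) (u : L1 R) n e : L1cvg u_ u ->
  (PC u -> (n%:R%:E <= J u)%E) -> 0 < e ->
  \forall k \near \oo, ((gamma * n%:R + norm1 (u \- f) - e)%:E <= F k (u_ k))%E.
Proof.
move=> /L1cvgP uu nJ e0; have e20 : 0 < e / 2 by rewrite divr_gt0.
have /cvgrPdist_lt/(_ _ e20) h1 := uu; have /cvgrPdist_lt/(_ _ e20) h2 :=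
  data_cvg.
have [d d0 Hd] : exists2 d, 0 < d &
    forall v : L1 R, norm1 (v \- u) < d -> PC v -> (n%:R%:E <= J v)%E.
  case: n nJ => [_|n nJ]; first by exists 1 => // v _ _; exact: J_ge0.
  by have [d d0 Hd] := J_lsc nJ; exists d.
have /cvgrPdist_lt/(_ _ d0) h3 := uu.
near=> k.
have q1 : norm1 (u_ k \- u) < e / 2.
  have : `|0 - norm1 (u_ k \- u)| < e / 2 by near: k.
  by rewrite sub0r normrN ger0_norm ?norm1_ge0.
have q2 : norm1 (g k \- f) < e / 2.
  have : `|0 - norm1 (g k \- f)| < e / 2 by near: k.
  by rewrite sub0r normrN ger0_norm ?norm1_ge0.
have q3 : norm1 (u_ k \- u) < d.
  have : `|0 - norm1 (u_ k \- u)| < d by near: k.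
  by rewrite sub0r normrN ger0_norm ?norm1_ge0.
have [uX|nuX] := pselect (PCk (X k) (u_ k)); last first.
  by rewrite /F /dPotts asboolF// leey.
rewrite /F dPottsE//; have [m Jm] := PC_J uX.1.
have := Hd _ q3 uX.1; rewrite Jm lee_fin => nm_.
rewrite -EFinM -EFinD lee_fin.
have := norm1_distD (L1_integrable01 u) (L1_integrable01 (u_ k))
  (L1_integrable01 f).
have := norm1_distD (L1_integrable01 (u_ k)) (hg k) (L1_integrable01 f).
rewrite (norm1_distC u (u_ k)) -/(g k) => t1 t2.
have : gamma * n%:R <= gamma * m%:R by rewrite ler_pM2l.
lra.
Unshelve. all: by end_near.
Qed.

Lemma Gamma_liminf (u_ : nat -> L1 R) (u : L1 R) : L1cvg u_ u ->
  (Potts gamma f u <= limn_einf (fun k => F k (u_ k)))%E.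
Proof.
move=> uu; have [uPC|nuPC] := pselect (PC u).
  have [n Jn] := PC_J uPC; rewrite PottsE// Jn -EFinM -EFinD.
  apply/lee_subgt0Pr => e e0; rewrite -EFinB; apply: limn_einf_ge.
  by apply: dPotts_eventually_ge => //; rewrite Jn.
rewrite [X in (X <= _)%E]/Potts asboolF// leye_eq; apply/eqP/eqyP => A A0.
(* The extra 1 absorbs the error e = 1 with which the eventual bound is applied. *)
pose n := Num.bound ((A + 1) / gamma).
have An : A + 1 <= gamma * n%:R.
  rewrite mulrC -ler_pdivrMr//; apply/ltW/archi_boundP.
  by rewrite divr_ge0 ?addr_ge0 // ltW.
apply: limn_einf_ge; have := @dPotts_eventually_ge u_ u n 1 uu (fun h =>
  False_ind _ (nuPC h)) ltr01.
apply: filterS => k; apply: le_trans; rewrite lee_fin.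
by have := norm1_ge0 (u \- f); lra.
Qed.

Lemma Gamma_recovery (u : L1 R) : exists u_ : nat -> L1 R, L1cvg u_ u /\
  (limn_esup (fun k => F k (u_ k)) <= Potts gamma f u)%E.
Proof.
have [uPC|nuPC] := pselect (PC u); last first.
  exists (fun=> u); split; last by rewrite [X in (_ <=
    X)%E]/Potts asboolF// leey.
  apply/L1cvgP; rewrite (_ : (fun n => _) = cst 0); first exact: cvg_cst.
  apply/funext => n; rewrite -[RHS]norm1_0; congr norm1.
  by apply/funext => x /=; rewrite subrr.
have [u_ [uu Hu]] := recovery hX uPC; exists u_; split => //.
have [n Jn] := PC_J uPC; rewrite PottsE// Jn -EFinM -EFinD.
apply/lee_addgt0Pr => e e0; rewrite -EFinD; apply: limn_esup_le.
have e20 : 0 < e / 2 by rewrite divr_gt0.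
have /L1cvgP/cvgrPdist_lt/(_ _ e20) h1 := uu.
have /cvgrPdist_lt/(_ _ e20) h2 := data_cvg.
near=> k.
have q1 : norm1 (u_ k \- u) < e / 2.
  have : `|0 - norm1 (u_ k \- u)| < e / 2 by near: k.
  by rewrite sub0r normrN ger0_norm ?norm1_ge0.
have q2 : norm1 (g k \- f) < e / 2.
  have : `|0 - norm1 (g k \- f)| < e / 2 by near: k.
  by rewrite sub0r normrN ger0_norm ?norm1_ge0.
have [uX Jle] := Hu k; rewrite /F dPottsE//; have [m Jm] := PC_J uX.1.
move: Jle; rewrite Jm Jn lee_fin => mn; rewrite -EFinM -EFinD lee_fin.
have := norm1_distD (L1_integrable01 (u_ k)) (L1_integrable01 u) (hg k).
have := norm1_distD (L1_integrable01 u) (L1_integrable01 f) (hg k).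
rewrite (norm1_distC f (g k)) -/(g k) => t1 t2.
have : gamma * m%:R <= gamma * n%:R by rewrite ler_pM2l.
lra.
Unshelve. all: by end_near.
Qed.

Lemma Gamma_cvg_Potts : Gamma_cvg (fun k => dPotts gamma (X k) (S k)) (Potts
  gamma f).
Proof. by split; [exact: Gamma_liminf|exact: Gamma_recovery]. Qed.

(* Replacing the value c j by 0 creates no jump, hence cannot decrease the functional. *)
Lemma minimizer_cell k (u : L1 R) (B : {fset R}) (c : nat -> R) j :
  minimizer (F k) u -> PCk (X k) u -> [set` B] = jumps u ->
  (u : R -> R) = stepfun B c %[ae mu] -> (j < ncells B)%N ->
  norm1 (fun x => c j * \1_(cell B j) x) <= 2 * norm1 (fun x =>
    g k x * \1_(cell B j) x).
Proof.
move=> umin uX BE uc jB.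
have B01 : [set` B] `<=` `[0, 1]%classic by rewrite BE; exact: jumps01.
pose c' i := if i == j then 0 else c i.
have [v vc'] := L1_exists (integrable01_stepfun B c').
have vB : ae_cst_off [set` enum_fset B] 0 1 v.
  exact: ae_eq_ae_cst_off vc' (ae_cst_off_stepfun (A := B) c').
have vX : PCk (X k) v.
  split; first exact: ae_cst_off_PC vB.
  by move=> t /(jumps_sub vB) tB; apply: uX.2; rewrite -BE.
have : (F k u <= F k v)%E by rewrite umin; apply: ereal_inf_lbound; exists v.
rewrite /F !dPottsE//; have [m Jm] := PC_J vX.1.
have := J_le (jumps_sub vB : jumps v `<=` [set` B]).
rewrite (J_fset BE) Jm -!EFinM -!EFinD !lee_fin -/(g k) => mB.
have : gamma * m%:R <= gamma * #|` B|%:R by rewrite ler_pM2l.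
move=> gmB ule; have {}ule : norm1 (u \- g k) <= norm1 (v \- g k) by lra.
have mI : measurable (cell B j) by exact: measurable_itv.
have hu := L1_integrable01 u; have hv := L1_integrable01 v.
have hug : integrable01 (u \- g k) by exact: integrable01B.
have hvg : integrable01 (v \- g k) by exact: integrable01B.
have hi : integrable01 (fun x => (u x - g k x) * \1_(cell B j) x) by exact:
  integrable01_mul_indic.
have hgi : integrable01 (fun x => g k x * \1_(cell B j) x) by exact:
  integrable01_mul_indic.
have nmDn (p q : R -> R) : integrable01 p -> integrable01 q ->
  norm1 p + norm1 q = norm1 (fun x => `|p x| + `|q x|).
  move=> hp hq; rewrite /norm1 -RintegralD//; [|exact: integrable01_norm..].
  by apply: eq_Rintegral => x _; rewrite [RHS]ger0_norm// addr_ge0.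
have Hn : \forall x \ae mu, 0 < x < 1 /\ x \notin nodes B by exact: (@ae01 _
  (nodes B)).
have key : forall x, 0 < x < 1 /\ x \notin nodes B ->
    (\1_(cell B j) x = 1 :> R /\ forall d : nat -> R, stepfun B d x = d j) \/
    (\1_(cell B j) x = 0 :> R /\ stepfun B c x = stepfun B c' x).
  move=> x [x01 xn]; have [i iB xi] := locate_cell x01 xn.
  have ixE d : stepfun B d x = d i by exact: stepfun_cell.
  have -> : \1_(cell B j) x = (i == j)%:R :> R.
    have := stepfun_cell (fun i => (i == j)%:R) iB xi.
    move=> <-; rewrite /stepfun (bigD1 (Ordinal jB))//= big1.
      by rewrite eqxx mul1r addr0.
    move=> l lj; rewrite (_ : (nat_of_ord l == j) = false) ?mul0r//.
    by apply: contraNF lj => /eqP lj; exact/eqP/val_inj.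
  by have [<-|ij] := eqVneq i j; [left|right; rewrite !ixE /c' (negbTE ij)].
have cut : norm1 (fun x => (u x - g k x) * \1_(cell B j) x) <=
    norm1 (fun x => g k x * \1_(cell B j) x).
  (* Almost everywhere the two integrands agree: off the cell u = v, and on it both equal |c_j - g|
     + |g|. Minimality of u then cancels everything outside the cell. *)
  suff : norm1 (v \- g k) + norm1 (fun x => (u x - g k x) * \1_(cell B j) x) <=
      norm1 (u \- g k) + norm1 (fun x => g k x * \1_(cell B j) x) by lra.
  rewrite !nmDn//; apply: norm1_le; [by apply: integrable01D;
    exact: integrable01_norm..|].
  apply: (ae_imp _ (ae_and Hn (ae_and uc vc'))) =>
    x /= [/key xk [/(_ I) -> /(_ I) ->]].
  case: xk => [[-> cE]|[-> ->]]; last by rewrite !mulr0.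
  by rewrite !cE /c' eqxx !mulr1 sub0r normrN addrC.
rewrite mulrDl mul1r; apply: (@le_trans _ _
  (norm1 (fun x => (u x - g k x) * \1_(cell B j) x) + norm1 (fun x =>
    g k x * \1_(cell B j) x))).
  apply: norm1_le_add => //; first exact: integrable01_scale_indic.
  apply: (ae_imp _ (ae_and Hn uc)) => x /= [/key xk /(_ I) ->].
  case: xk => [[-> cE]|[-> _]]; last by rewrite !mulr0 normr0 addr0.
  by rewrite cE !mulr1; have := ler_normD (c j - g k x) (g k x); rewrite subrK.
by rewrite lerD2r.
Qed.

Lemma minimizers_compact (u_ : nat -> L1 R) :
  (forall k, minimizer (F k) (u_ k)) -> exists u :
    L1 R, accumulation_point u_ u.
Proof.
move=> umin.
have [M M0 gM] : exists2 M, 0 <= M & forall k, norm1 (g k) <= M.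
  have [M [_ HM]] := cvg_seq_bounded (cvgP _ data_cvg).
  exists (`|M| + 1 + norm1 f) => [|k]; first by rewrite !addr_ge0 ?norm1_ge0.
  have : norm1 (g k) <= norm1 (g k \- f) + norm1 f.
    apply: norm1_le_add => //; [by apply: integrable01B => //;
      exact: L1_integrable01|exact: L1_integrable01|].
    apply: aeW => x /=; have := ler_normD (g k x - f x) (f x); by rewrite subrK.
  have MM : M < `|M| + 1 by rewrite (le_lt_trans (ler_norm M))// ltrDl.
  have := HM _ MM k I.
  rewrite /= ger0_norm ?norm1_ge0//; lra.
(* The zero function is admissible for every k and costs only the norm of the data, which bounds the
   jumps of all minimizers by M / gamma. *)
have [z0 z0E] := @L1_exists R _ (integrable01_cst 0).
have z0P : ae_cst_off [set` [::]] 0 1 z0.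
  by move=> a b _ _ _ _; exists 0; apply: ae_imp z0E => x /(_ I).
have z0X k : PCk (X k) z0.
  by split; [exact: ae_cst_off_PC z0P|move=> t /(jumps_sub z0P)].
have Jz0 : J z0 = 0%E.
  apply/eqP; rewrite eq_le J_ge0 andbT.
  by apply: (@J_le R fset0) => t /(jumps_sub z0P).
pose m := Num.bound (M / gamma).
have uE k : PCk (X k) (u_ k) /\ exists2 n : nat, (n <=
  m)%N & J (u_ k) = n%:R%:E.
  have H : (F k (u_ k) <= F k z0)%E by rewrite umin; apply: ereal_inf_lbound;
    exists z0.
  rewrite /F [X in (_ <= X)%E]dPottsE// Jz0 mule0 add0e in H.
  have [uX|nuX] := pselect (PCk (X k) (u_ k)); last first.
    by move: H; rewrite /dPotts asboolF// leye_eq.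
  split => //; have [n Jn] := PC_J uX.1; exists n => //.
  move: H; rewrite dPottsE// Jn -EFinM -EFinD lee_fin => uz.
  rewrite -(ler_nat R); apply: (@le_trans _ _ (M / gamma)); last first.
    by apply/ltW/archi_boundP; rewrite divr_ge0// ltW.
  rewrite ler_pdivlMr// mulrC; have := gM k; have := norm1_ge0 (u_ k \- g k).
  suff : norm1 (z0 \- g k) <= norm1 (g k) by rewrite -/(g k) in uz *; lra.
  apply: norm1_le => //; first by apply: integrable01B => //;
    exact: L1_integrable01.
  by apply: (ae_imp _ z0E) => x /= /(_ I) ->; rewrite sub0r normrN.
have /choice[Bc HBc] : forall k, exists Bc : {fset R} * (nat -> R),
    [/\ [set` Bc.1] = jumps (u_ k), (ncells Bc.1 <= m.+1)%N &
      (u_ k : R -> R) = stepfun Bc.1 Bc.2 %[ae mu]].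
  move=> k; have [uX [n nm_ Jn]] := uE k; have [B [BE _ [c uc]]] :=
    PC_jumps uX.1.
  exists (B, c); split => //=; apply: leq_trans (ncells_le B) _; rewrite ltnS.
  apply: leq_trans nm_; move: Jn; rewrite (J_fset BE) => -[/eqP].
  by rewrite eqr_nat => /eqP ->.
pose B k := (Bc k).1; pose N k := ncells (B k).
have BE k : [set` B k] = jumps (u_ k) by have [] := HBc k.
have Nm k : (N k <= m.+1)%N by have [] := HBc k.
have B01 k : [set` B k] `<=` `[0, 1]%classic by rewrite BE; exact: jumps01.
(* The number of cells varies with k, whereas the compactness of sums needs a fixed number of terms.
   Zero values on intervals [0, 0] pad each function to m + 1 terms, enough for at most m jumps. *)
pose c k j : R := if (j < N k)%N then (Bc k).2 j else 0.
pose s k j : R := if (j < N k)%N then nth 0 (nodes (B k)) j else 0.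
pose t k j : R := if (j < N k)%N then nth 0 (nodes (B k)) j.+1 else 0.
have stP k j : [/\ 0 <= s k j, s k j <= t k j & t k j <= 1].
  rewrite /s /t; case: ifPn => jN; last by rewrite lexx ler01.
  have /andP[p0 _] := nth_nodes01 (B01 k) (ltnW jN).
  have /andP[_ q1] := nth_nodes01 (B01 k) jN.
  by split => //; exact: nodes_le.
have ctP k j : `|c k j| * (t k j - s k j) <= 2 * norm1 (fun x =>
  g k x * \1_`[s k j, t k j] x).
  have [s0 st t1] := stP k j.
  have [jN|jN] := ltnP j (N k); last first.
    by rewrite /c ltnNge jN/= normr0 mul0r mulr_ge0// norm1_ge0.
  rewrite -norm1_indic// -norm1Z; last exact: integrable01_itv.
  rewrite /c /s /t jN; apply: minimizer_cell (umin k) (uE k).1 (BE k) _ jN.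
  by have [] := HBc k.
have [phi [phi_incr [h hh lim0]]] := terms_compact m.+1 hg data_cvg gM stP ctP.
have [u uh] := L1_exists hh.
exists u, phi; split => //; apply/L1cvgP.
apply: cvg_trans lim0; apply: near_eq_cvg; apply: nearW => n /=.
set k := phi n.
have hsum : integrable01 (fun x => \sum_(j < m.+1) c k j * \1_`[s k j, t k j]
  x).
  exact: (integrable01_cell_sum m.+1 (c k) (s k) (t k)).
apply: ae_eq_norm1; [exact: integrable01B|by apply: integrable01B;
  exact: L1_integrable01|].
have [_ _ uc] := HBc k.
apply: (ae_imp _ (ae_and uc uh)) => x /= [/(_ I) -> /(_ I) ->] _; congr (_ - _).
rewrite /stepfun -/(B k) -/(N k) (big_ord_widen m.+1 (fun j =>
  (Bc k).2 j * \1_(cell (B k) j) x) (Nm k)).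
rewrite [RHS]big_mkcond/=; apply: eq_bigr => j _; rewrite /c /s /t.
by case: ifPn => // _; rewrite mul0r.
Qed.

End discretized.
End potts.

(** Density survives because k <= phi k puts [X k] inside [X (phi k)]. *)
Lemma discretization_sets_subseq (R : realType) (X : nat -> {fset R}) phi :
  increasing_seq phi -> discretization_sets X -> discretization_sets (X \o phi).
Proof.
move=> phi_incr hX; have /increasing_seqP incr := phi_incr; split => /=.
- by move=> k; exact: (@disc_sub _ _ hX (phi k)).
- by move=> k; apply: disc_mono => //; exact/ltnW/incr.
- move=> k; apply: leq_trans (disc_card hX (phi k)) _.
  by apply: fsubset_leq_card; apply: disc_mono => //; exact: incr.
- apply: subset_trans (disc_dense hX) _; apply: closure_subset => x [k _ xk].
  exists k => //=; apply: (fsubsetP (disc_mono hX _)) xk.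
  exact: increasing_seq_ge.
Qed.

Theorem theorem2p9 (R : realType) (f : L1 R) (gamma : R)
    (X : nat -> {fset R}) (S : nat -> nat -> R)
    (hgamma : 0 < gamma)
    (hX : discretization_sets X)
    (hS : sampling f X S) :
  Gamma_cvg (fun k => dPotts gamma (X k) (S k)) (Potts gamma f) /\
  (forall u_ : nat -> L1 R,
     (forall k, minimizer (dPotts gamma (X k) (S k)) (u_ k)) ->
     (exists ustar : L1 R, accumulation_point u_ ustar) /\
     (forall ustar : L1 R, accumulation_point u_ ustar ->
        minimizer (Potts gamma f) ustar)).
Proof.
split; first exact: Gamma_cvg_Potts.
move=> u_ umin; split; first exact: (minimizers_compact hgamma hX hS umin).
move=> u [phi [phi_incr uphi]].
have hX' := discretization_sets_subseq phi_incr hX.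
have hS' : sampling f (X \o phi) (S \o phi).
  case: hS => [h|[g [gc fg h]]]; [left|right] => /=; first by move=> k;
    exact: h.
  by exists g; split => // k; exact: h.
have [liminf limsup] := Gamma_cvg_Potts hgamma hX' hS'.
apply/eqP; rewrite eq_le; apply/andP; split; last by apply: ereal_inf_lbound;
  exists u.
(* A recovery sequence of an arbitrary v along the same subsequence competes with the minimizers
   index by index; the lower bound at u and the upper bound at v enclose this comparison. *)
apply: le_ereal_inf_tmp => _ [v _ <-]; have [v_ [vv vle]] := limsup v.
apply: le_trans (liminf _ _ uphi) _; apply: le_trans vle.
apply: le_trans (limn_einf_sup _); apply: le_limn_einf => k /=.
by rewrite (umin (phi k)); apply: ereal_inf_lbound; exists (v_ k).
Qed.
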